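(* Let $W_\infty\in\mathcal W_v$ satisfy $W_\infty>0$ Lebesgue-a.e. and $\mathcal V[W_\infty](x)=1$ for Lebesgue-a.e. $x\in[0,1]$. For $\theta\ge0$ consider the optimization problem $$\sup_{\boldsymbol f\in\mathcal F_c}\left\{\theta\sum_{r=1}^cG_{W_\infty,\mathbf 1_r}(\boldsymbol f)-\int_0^1\sum_{r=1}^c f_r(u)\log f_r(u)\,du\right\}-\log c\qquad(\ast)$$ (i.e. the case $\alpha_r=\theta$, $h_r=0$ for all $r\in[c]$). Then the following hold. (i) Any optimizer $(x_1,\ldots,x_c)\in\Delta_{c-1}$ with $x_1\ge\max_{2\le r\le c}x_r$ has the form $$x_1=\frac1c\big(1+(c-1)y^*\big),\qquad x_r=\frac1c(1-y^* ),\quad 2\le r\le c,$$ for some $0\le y^*<1$. (ii) There exists $\theta_{\rm crit}\in(0,\infty)$ such that: if $\theta<\theta_{\rm crit}$, then $(1/c,\ldots,1/c)$ is the unique optimizer of $(\ast)$; and if $\theta>\theta_{\rm crit}$, there exist exactly $c$ distinct optimizers, none of which are uniform. With $(x_{\theta,1},\ldots,x_{\theta,c})$ denoting, for $\theta>\theta_{\rm crit}$, the unique optimizer satisfying $x_{\theta,1}>\max_{2\le r\le c}x_{\theta,r}$, the map $\theta\mapsto(x_{\theta,1},\ldots,x_{\theta,c})$ is continuous on $(\theta_{\rm crit},\infty)$.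
   Context: Integers $c,v\ge2$ are fixed and $[m]:=\{1,\ldots,m\}$. $\mathcal W_v$ is the space of symmetric real-valued functions in $L^1([0,1]^v)$. $\mathcal F_c$ is the set of measurable $\boldsymbol f=(f_1,\ldots,f_c):[0,1]\to[0,1]^c$ with $\sum_{r=1}^c f_r(x)=1$ for all $x$ (modulo a.e. equality). $\Delta_{c-1}:=\{(y_1,\ldots,y_c)\in[0,1]^c:\sum_r y_r=1\}$. For $W\in\mathcal W_v$, $$G_{W,\mathbf 1_r}(\boldsymbol f):=\int_{[0,1]^v}W(x_1,\ldots,x_v)\prod_{a=1}^v f_r(x_a)\,dx_1\cdots dx_v,\qquad\mathcal V[W](x):=\int_{[0,1]^{v-1}}W(x,x_2,\ldots,x_v)\prod_{a=2}^v dx_a.$$ Under these hypotheses on $W_\infty$ and $\theta\ge 0$, all maximizers of $(\ast)$ over $\mathcal F_c$ are a.e. constant, and an a.e. constant $\boldsymbol f\equiv(x_1,\ldots,x_c)$ is identified with the vector $(x_1,\ldots,x_c)\in\Delta_{c-1}$; ''optimizer'' means maximizer over $\mathcal F_c$ under this identification. Convention: $0\log0=0$. *)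

(* Defs.v *)
From HB Require Import structures.
From mathcomp Require Export all_boot all_order all_algebra perm.
From mathcomp Require Export all_classical all_reals all_analysis.

Set Implicit Arguments.
Unset Strict Implicit.
Unset Printing Implicit Defensive.

Export Order.TTheory GRing.Theory Num.Theory.
Export numFieldNormedType.Exports.

Local Open Scope classical_set_scope.
Local Open Scope ring_scope.

(* Functions on [0,1] (resp. [0,1]^n) are represented by functions on R
   (resp. on n-tuples of reals), and [0,1]^n carries the measure [leb01n n],
   which does not charge the complement of the cube: integrals and almost
   everywhere statements only see the values on the cube. *)
Definition leb01 (R : realType) :
    set (measurableTypeR R) -> \bar R :=
  mrestr (@lebesgue_measure R) (measurable_itv `[0%R, 1%R]%R).
Arguments leb01 R : clear implicits.

Section leb01_probability.
Variable R : realType.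

HB.instance Definition _ := Measure.on (leb01 R).

Let leb01_setT : leb01 R setT = 1%E.
Proof.
rewrite /leb01 /mrestr setTI lebesgue_measure_itv/= lte_fin ltr01.
by rewrite -EFinD subr0.
Qed.

HB.instance Definition _ :=
  Measure_isProbability.Build _ _ _ (leb01 R) leb01_setT.

End leb01_probability.

Section tuple_cons.
Context d (T : measurableType d) (n : nat).

Definition tuple_cons (p : T * n.-tuple T) : n.+1.-tuple T :=
  [the n.+1.-tuple T of p.1 :: p.2].

Lemma measurable_tuple_cons : measurable_fun [set: T * n.-tuple T] tuple_cons.
Proof. exact: measurable_cons measurable_fst measurable_snd. Qed.

HB.instance Definition _ :=
  isMeasurableFun.Build _ _ _ _ tuple_cons measurable_tuple_cons.

End tuple_cons.

Fixpoint leb01n (R : realType) (n : nat) :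
    probability (n.-tuple (measurableTypeR R)) R :=
  match n with
  | 0 => dirac [tuple]
  | m.+1 => distribution (leb01 R \x leb01n R m)%E
              (tuple_cons (T := measurableTypeR R) (n := m))
  end.

Lemma leb01n_box (R : realType) (n : nat)
    (A : 'I_n -> set (measurableTypeR R)) :
  (forall i, measurable (A i)) ->
  leb01n R n [set t | forall i, A i (tnth t i)] =
  (\prod_(i < n) leb01 R (A i))%E.
Proof.
elim: n A => [|n IH] A mA /=.
  rewrite big_ord0 diracE mem_set//; by move=> [].
rewrite big_ord_recl /distribution /pushforward.
rewrite (_ : _ @^-1` _ = A ord0 `*` [set t | forall i, A (lift ord0 i) (tnth t i)]); last first.
  apply/seteqP; split=> -[x t] /=.
    move=> h; split; first exact: (h ord0).
    by move=> i; have := h (lift ord0 i); rewrite tnthS.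
  move=> [h0 h] i; case: (unliftP ord0 i) => [j|] -> //.
  by rewrite tnthS.
rewrite product_measure1E//; last first.
  rewrite (_ : [set _ | _] = \bigcap_(i in [set: 'I_n]) ((fun t => tnth t i) @^-1` A (lift ord0 i))).
    apply: fin_bigcap_measurable => // i _.
    by rewrite -[X in measurable X]setTI; exact: measurable_tnth.
  by apply/seteqP; split=> t /= h i; [move=> _; exact: h|exact: (h i Logic.I)].
by congr (_ * _)%E; exact: IH.
Qed.

Definition Wspace (R : realType) (v : nat) :
    set (v.-tuple (measurableTypeR R) -> R) :=
  [set W | (leb01n R v).-integrable setT (EFin \o W) /\
    forall s : {perm 'I_v},
      {ae leb01n R v, forall x, W [tuple tnth x (s i) | i < v] = W x}].

Definition simplex (R : realType) (c : nat) : set 'rV[R]_c :=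
  [set y | (forall r, 0 <= y 0 r <= 1) /\ \sum_(r < c) y 0 r = 1].

(* [f] is the vector (f_1, ..., f_c); its values off [0,1] are irrelevant, so
   asking for measurability on all of R is no loss of generality. *)
Definition Fspace (R : realType) (c : nat) :
    set (measurableTypeR R -> 'rV[R]_c) :=
  [set f : measurableTypeR R -> 'rV[R]_c |
    (forall r, measurable_fun setT
       (fun x => f x 0 r : measurableTypeR R)) /\
    forall x, 0 <= x <= 1 -> simplex (f x)].

Definition Gmono (R : realType) (c v : nat)
    (W : v.-tuple (measurableTypeR R) -> R) (r : 'I_c)
    (f : measurableTypeR R -> 'rV[R]_c) : R :=
  \int[leb01n R v]_x (W x * \prod_(a < v) f (tnth x a) 0 r).

(* [nth 0 (x :: y) i], for i < v, lists the arguments (x, x_2, ..., x_v). *)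
Definition Vdeg (R : realType) (v : nat)
    (W : v.-tuple (measurableTypeR R) -> R) (x : measurableTypeR R) : R :=
  \int[leb01n R v.-1]_y W [tuple nth 0 (x :: y) i | i < v].

(* [ln 0 = 0], hence the convention 0 log 0 = 0 holds. *)
Definition objective (R : realType) (c v : nat)
    (W : v.-tuple (measurableTypeR R) -> R) (theta : R)
    (f : measurableTypeR R -> 'rV[R]_c) : R :=
  theta * (\sum_(r < c) Gmono W r f)
  - \int[leb01 R]_u (\sum_(r < c) f u 0 r * ln (f u 0 r))
  - ln c%:R.

Definition maximizer (R : realType) (c v : nat)
    (W : v.-tuple (measurableTypeR R) -> R) (theta : R)
    (f : measurableTypeR R -> 'rV[R]_c) : Prop :=
  Fspace f /\ forall g : measurableTypeR R -> 'rV[R]_c,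
    Fspace g -> objective W theta g <= objective W theta f.

(* An a.e. constant maximizer is identified with its a.e. value. *)
Definition optimizers (R : realType) (c v : nat)
    (W : v.-tuple (measurableTypeR R) -> R) (theta : R) : set 'rV[R]_c :=
  [set x | simplex x /\
    exists2 f : measurableTypeR R -> 'rV[R]_c, maximizer W theta f &
      {ae leb01 R, forall u, f u = x}].
Arguments optimizers {R} c {v} W theta.

Definition uniform_vec (R : realType) (c : nat) : 'rV[R]_c :=
  const_mx (c%:R^-1).

Definition first_color (c : nat) (hc : (1 < c)%N) : 'I_c := Ordinal (ltnW hc).

(* Main.v *)
(* Let Phi(x) = theta sum_r x_r^v - sum_r x_r log x_r on the simplex. By AM-GM,
   prod_a f_r(x_a) <= (1/v) sum_a f_r(x_a)^v, so the symmetry and the unit degree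
   of W give G_r(f) <= int f_r^v, and the functional is at most int Phi(f(u)) du.
   Equality forces f_r(x_1) = ... = f_r(x_v) almost everywhere because W > 0.
   Hence the maximizers are the constants maximizing Phi.

   For a maximizer of Phi the derivative g(t) = theta v t^(v-1) - log t takes the
   same value at all coordinates, g decreases and then increases, and two
   coordinates cannot both lie on the increasing branch: one coordinate is b and
   the others are a <= b. Set z = b/a, m = c - 1, p = v - 1. Then z > 1 is a
   critical point iff E(z) := log z (z+m)^p / (z^p - 1) equals theta v. The sign
   of E' changes at most once on (1,oo), from - to +, so among two critical points
   the first is a local minimum, and there is at most one maximizer with z > 1.
   The single sign change is obtained from polynomials by repeated integration.

   theta_crit is the supremum of the theta for which the uniform vector is a
   maximizer; below it the uniform vector is the only one since Phi is affine in
   theta. Continuity of the branch is compactness together with uniqueness. *)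
From HB Require Import structures.
Require Import Defs.
From mathcomp Require Import measurable_realfun lra.

Set Implicit Arguments.
Unset Strict Implicit.
Unset Printing Implicit Defensive.

Local Open Scope classical_set_scope.
Local Open Scope ring_scope.

(** * Single crossing *)

Section pointwise_derivatives.
Variable R : realType.
Implicit Types (f g : R -> R) (x a b : R).

Lemma is_derive1D f g x a b : is_derive x 1 f a -> is_derive x 1 g b ->
  is_derive x 1 (fun t => f t + g t) (a + b).
Proof. exact: is_deriveD. Qed.

Lemma is_derive1B f g x a b : is_derive x 1 f a -> is_derive x 1 g b ->
  is_derive x 1 (fun t => f t - g t) (a - b).
Proof. exact: is_deriveB. Qed.

Lemma is_derive1M f g x a b : is_derive x 1 f a -> is_derive x 1 g b ->
  is_derive x 1 (fun t => f t * g t) (a * g x + f x * b).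
Proof.
move=> fa gb; apply: is_derive_eq (is_deriveM fa gb) _.
by rewrite /GRing.scale/=; lra.
Qed.

Lemma is_derive1X f n x a : is_derive x 1 f a ->
  is_derive x 1 (fun t => f t ^+ n) (n%:R * f x ^+ n.-1 * a).
Proof.
move=> fa; have := is_deriveX n fa.
rewrite (_ : f ^+ n = fun t => f t ^+ n)//.
by apply/funext => t; rewrite exprfctE.
Qed.

Lemma is_derive1V f x a : f x != 0 -> is_derive x 1 f a ->
  is_derive x 1 (fun t => (f t)^-1) (- a / f x ^+ 2).
Proof.
move=> fx0 fa; apply: is_derive_eq (is_deriveV fx0 fa) _.
by rewrite /GRing.scale/=; lra.
Qed.

Lemma is_derive1_div f g x a b : g x != 0 ->
  is_derive x 1 f a -> is_derive x 1 g b ->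
  is_derive x 1 (fun t => f t / g t) ((a * g x - f x * b) / g x ^+ 2).
Proof.
move=> gx0 fa gb; apply: is_derive_eq (is_derive1M fa (is_derive1V gx0 gb)) _.
by rewrite mulrBl expr2 invfM !mulrA mulfK// mulrN !mulNr.
Qed.

Lemma is_derive1_ln_comp f x a : 0 < f x -> is_derive x 1 f a ->
  is_derive x 1 (fun t => ln (f t)) (a / f x).
Proof.
move=> fx0 fa; have := is_derive1_comp (is_derive1_ln fx0) fa.
by move=> h; apply: is_derive_eq h _; rewrite mulrC.
Qed.

Lemma is_derive1_cst a x : is_derive x 1 (fun _ : R => a) 0.
Proof. exact: is_derive_cst. Qed.

Lemma is_derive1_id x : is_derive x 1 (fun t : R => t) 1.
Proof. exact: is_derive_id. Qed.

Lemma is_derive1_continuous f x a : is_derive x 1 f a -> {for x, continuous f}.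
Proof.
by move=> fa; apply/differentiable_continuous/derivable1_diffP/ex_derive.
Qed.

Lemma is_derive1_MVT f (df : R -> R) a b : a < b ->
  (forall x, a <= x <= b -> is_derive x 1 f (df x)) ->
  exists2 x, a < x < b & f b - f a = df x * (b - a).
Proof.
move=> ab dfx; have [||x xab ->] := @MVT R f df a b ab.
- by move=> x; rewrite in_itv/= => /andP[? ?]; apply: dfx; rewrite !ltW.
- apply: continuous_in_subspaceT => x; rewrite inE/= in_itv/= => /dfx.
  exact: is_derive1_continuous.
- by exists x; rewrite // in_itv/= in xab.
Qed.

End pointwise_derivatives.

(** The quotient case must precede the product case, since a quotient is a product with an inverse.
    Side conditions such as nonvanishing denominators are left as goals. *)
Ltac derive_pointwise := match goal with
  | |- is_derive _ _ (fun _ => ?a) _ => apply: is_derive1_cst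
  | |- is_derive _ _ (fun t => t) _ => apply: is_derive1_id
  | |- is_derive _ _ (fun t => _ - _) _ => apply: is_derive1B; derive_pointwise
  | |- is_derive _ _ (fun t => _ + _) _ => apply: is_derive1D; derive_pointwise
  | |- is_derive _ _ (fun t => @GRing.mul _ _ (@GRing.inv _ _)) _ =>
    apply: is_derive1_div; derive_pointwise
  | |- is_derive _ _ (fun t => _ * _) _ => apply: is_derive1M; derive_pointwise
  | |- is_derive _ _ (fun t => _ ^+ _) _ => apply: is_derive1X; derive_pointwise
  | |- is_derive _ _ (fun t => @GRing.inv _ _) _ =>
    apply: is_derive1V; derive_pointwise
  | |- is_derive _ _ (@ln _) _ => apply: is_derive1_ln
  | |- is_derive _ _ (fun t => ln _) _ =>
    apply: is_derive1_ln_comp; derive_pointwise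
  | _ => idtac end.

(** * Functions with a single sign change on (1, oo) *)

Section single_crossing.
Variable R : realType.
Implicit Types (f g df : R -> R).

(** A weak hypothesis with a strict conclusion: at most one zero on (1, oo), with sign change from -
    to +. Functions of constant strict sign qualify. *)
Definition single_crossing f :=
  forall z w : R, 1 < z -> z < w -> 0 <= f z -> 0 < f w.

Lemma single_crossing_ext f g : (forall z : R, 1 < z -> f z = g z) ->
  single_crossing f -> single_crossing g.
Proof.
move=> fg scf z w z1 zw.
by rewrite -(fg z)// -(fg w) ?(lt_trans z1)//; exact: scf.
Qed.

Lemma single_crossing_pos f : (forall z : R, 1 < z -> 0 < f z) ->
  single_crossing f.
Proof. by move=> f0 z w z1 zw _; apply: f0; apply: lt_trans zw. Qed.

Lemma single_crossingM f g : (forall z : R, 1 < z -> 0 < f z) ->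
  single_crossing g -> single_crossing (fun z => f z * g z).
Proof.
move=> f0 scg z w z1 zw.
rewrite pmulr_rge0 ?f0// pmulr_rgt0 ?f0 ?(lt_trans z1)//; exact: scg.
Qed.

(** If [f z >= 0 >= f 1], the mean value theorem gives a point of (1, z) where [df >= 0]. Beyond
    that point [df] is positive, so [f] increases strictly after [z]. *)
Lemma single_crossing_antiderivative f df :
  (forall z : R, 1 <= z -> is_derive z 1 f (df z)) -> f 1 <= 0 ->
  single_crossing df -> single_crossing f.
Proof.
move=> dfz f1 scdf z w z1 zw fz0.
have [|x /andP[x1 xz] fx] := is_derive1_MVT z1 (df := df) (f := f).
  by move=> x /andP[x1 _]; exact: dfz.
have dfx : 0 <= df x.
  rewrite -(pmulr_lge0 (x := z - 1)) ?subr_gt0// -fx.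
  by rewrite subr_ge0; apply: le_trans fz0.
have [|y /andP[zy yw] fy] := is_derive1_MVT zw (df := df) (f := f).
  by move=> y /andP[y1 _]; apply: dfz; apply: le_trans (ltW z1) y1.
apply: le_lt_trans fz0 _; rewrite -subr_gt0 fy mulr_gt0 ?subr_gt0//.
by apply: scdf dfx => //; apply: lt_trans zy.
Qed.

End single_crossing.

(** * The sign of the derivative along the ratio of two coordinates *)

Section ratio.
Variables (R : realType) (m : R).
Hypothesis m1 : 1 <= m.

(* Up to a positive factor, the derivative of
   [(z + m) (z ^ p - 1) / (z + m z ^ p) - p log z], with [p = k + 1]. *)
Lemma single_crossing_poly k : single_crossing (fun z : R =>
  m * z ^+ k.+1 - k.+1%:R * m ^+ 2 * z ^+ k + k.+1%:R * z - m).
Proof.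
have m0 : 0 < m by apply: lt_le_trans m1.
case: k => [|k].
  apply: (@single_crossing_ext _ (fun z : R => (m + 1) * (z - m))).
    by move=> z _; rewrite !expr1 !expr0; lra.
  apply: single_crossingM => [z _|]; first by rewrite addr_gt0.
  by move=> z w _ zw; rewrite subr_ge0 subr_gt0 => mz; apply: le_lt_trans zw.
pose p : R := k.+2%:R.
(* Division by [z] makes the linear term constant, so differentiation removes it. The quotient
   equals [p * (1 - m ^+ 2) <= 0] at 1, which is where [1 <= m] enters. *)
apply: (@single_crossing_ext _ (fun z : R => z *
    (m * z ^+ k.+1 - p * m ^+ 2 * z ^+ k + p - m / z))).
  move=> z z1; rewrite mulrBr [z * (m / z)]mulrC divfK.
    by rewrite -/p !exprS; lra.
  by rewrite gt_eqF// (lt_trans _ z1).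
apply: single_crossingM => [z z1|]; first by rewrite (lt_trans _ z1).
apply: (@single_crossing_antiderivative _ _ (fun z => m / z ^+ 2 *
    (k.+1%:R * z ^+ k.+2 - k%:R * p * m * z ^+ k.+1 + 1))).
- move=> z z1; have z0 : z != 0 by rewrite gt_eqF// (lt_le_trans _ z1).
  apply: is_derive_eq; first by derive_pointwise; rewrite ?expf_neq0.
  rewrite /=.
  have zV : z * z * (z ^+ 2)^-1 = 1 by rewrite -expr2 mulfV// expf_neq0.
  set u := _^-1 in zV *.
  case: k @p => [|k] p /=; rewrite !exprS ?expr0.
    by have := congr1 (fun t => m * t) zV; lra.
  (* Given suitable multiples of [z * z * u = 1], the identity is linear in
     the monomials. *)
  set y := z ^+ k; set a := k.+2%:R.
  have := congr1 (fun t => m * a * z * y * t) zV.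
  have := congr1 (fun t => m * m * k.+1%:R * p * y * t) zV => /=.
  by set b := k.+1%:R; lra.
- rewrite !expr1n !mulr1 invr1 mulr1.
  have : p <= p * m ^+ 2 by rewrite ler_peMr ?ler0n// exprn_ege1.
  lra.
- apply: single_crossingM => [z z1|].
    by rewrite divr_gt0// exprn_gt0// (lt_trans _ z1).
  case: k @p => [|k] p.
    apply: single_crossing_pos => z z1.
    by rewrite !mul0r subr0 mul1r addr_gt0// exprn_gt0// (lt_trans _ z1).
  have pE : p = k.+1%:R + 2 by rewrite /p -addn2 natrD.
  have kE : k.+2%:R = k.+1%:R + 1 :> R by rewrite -addn1 natrD.
  (* A second differentiation leaves a positive multiple of a linear factor. The value at 1 is
     [p * (1 - k.+1%:R * m) <= 0]. *)
  apply: (@single_crossing_antiderivative _ _ (fun z =>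
      (k.+2%:R * p * z ^+ k.+1) * (z - k.+1%:R * m))).
  + move=> z z1; apply: is_derive_eq; first by derive_pointwise.
    by rewrite -/p /= !exprS !kE; lra.
  + have : 1 <= k.+1%:R * m by rewrite -[leLHS]mulr1 ler_pM// ler1n.
    rewrite !expr1n !mulr1 kE -subr_ge0 => h.
    have := mulr_ge0 (ler0n R k.+3) h; rewrite -/p.
    by rewrite pE; set b := k.+1%:R; lra.
  + apply: single_crossingM => [z z1|].
      by rewrite !mulr_gt0 ?ltr0n// exprn_gt0// (lt_trans _ z1).
    by move=> z w _ zw; rewrite subr_ge0 subr_gt0 => mz; apply: le_lt_trans zw.
Qed.

(* Up to a positive factor, the derivative of
   [log z (z + m) ^ p / (z ^ p - 1)], with [p = k + 1]. *)
Lemma single_crossing_log k : single_crossing (fun z : R =>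
  (z + m) * (z ^+ k.+1 - 1) - k.+1%:R * ln z * (z + m * z ^+ k.+1)).
Proof.
have m0 : 0 < m by apply: lt_le_trans m1.
have M0 (z : R) : 0 < z -> 0 < z + m * z ^+ k.+1.
  by move=> z0; rewrite addr_gt0// mulr_gt0// exprn_gt0.
(* Once the coefficient of the logarithm is constant, one differentiation gives a rational
   function. *)
apply: (@single_crossing_ext _ (fun z : R => (z + m * z ^+ k.+1) *
    ((z + m) * (z ^+ k.+1 - 1) / (z + m * z ^+ k.+1) - k.+1%:R * ln z))).
  move=> z z1; rewrite mulrBr mulrC divfK ?gt_eqF ?M0 ?(lt_trans _ z1)//.
  by congr (_ - _); exact: mulrC.
apply: single_crossingM => [z z1|]; first by rewrite M0// (lt_trans _ z1).
apply: (@single_crossing_antiderivative _ _ (fun z =>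
   ((z ^+ k.+1 - 1) / (z + m * z ^+ k.+1) ^+ 2) *
   (m * z ^+ k.+1 - k.+1%:R * m ^+ 2 * z ^+ k + k.+1%:R * z - m))).
- move=> z z1; have z0 : 0 < z by rewrite (lt_le_trans _ z1).
  have zN0 := lt0r_neq0 z0; have Mz := lt0r_neq0 (M0 _ z0).
  apply: is_derive_eq; first by derive_pointwise.
  rewrite /= [0 * ln z]mul0r add0r -[- (_ / z)]mulNr addf_div ?expf_neq0//.
  apply/eqP; rewrite [eqbRHS]mulrAC eqr_div ?mulf_neq0 ?expf_neq0//.
  rewrite /= !exprS ?expr0; apply/eqP.
  by set y := z ^+ k; set P := k.+1%:R; lra.
- by rewrite expr1n subrr mulr0 mul0r ln1 mulr0 subrr.
- apply: single_crossingM; last exact: single_crossing_poly.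
  move=> z z1; have z0 : 0 < z by rewrite (lt_trans _ z1).
  rewrite divr_gt0 ?exprn_gt0 ?M0// subr_gt0.
  by rewrite exprn_egt1.
Qed.

(** [A] is a positive multiple of [t - E], where [E] is [ln x * (x + m) ^+ k.+1 / (x ^+ k.+1 - 1)].
    Since [E = t] at both roots, [E'] vanishes between them. Single crossing makes [E'] negative
    before that point, so [E z > t]. *)
Lemma log_ratio_before_second_root k (t z1 z2 z : R) :
  let A (x : R) := t * (x ^+ k.+1 - 1) / (x + m) ^+ k.+1 - ln x in
  1 < z -> z < z1 -> z1 < z2 -> A z1 = 0 -> A z2 = 0 -> A z < 0.
Proof.
move=> A z_1 zz1 z12 A1 A2.
have m0 : 0 < m by apply: lt_le_trans m1.
have [z1_1 z2_1] : 1 < z1 /\ 1 < z2.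
  by split; [|apply: lt_trans z12]; apply: lt_trans zz1.
pose E x := ln x * (x + m) ^+ k.+1 / (x ^+ k.+1 - 1).
pose dE x := ((x + m) ^+ k / (x * (x ^+ k.+1 - 1) ^+ 2)) *
  ((x + m) * (x ^+ k.+1 - 1) - k.+1%:R * ln x * (x + m * x ^+ k.+1)).
have D0 (x : R) : 1 < x -> 0 < x ^+ k.+1 - 1.
  by move=> x1; rewrite subr_gt0 exprn_egt1.
have xm0 (x : R) : 1 < x -> 0 < x + m.
  by move=> x1; rewrite addr_gt0// (lt_trans _ x1).
have dEx (x : R) : 1 < x -> is_derive x 1 E (dE x).
  move=> x1; have x0 : 0 < x by rewrite (lt_trans _ x1).
  have DN0 := lt0r_neq0 (D0 _ x1).
  rewrite /E; apply: is_derive_eq; first by derive_pointwise.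
  rewrite /dE /= [(x * _)^-1]invfM [(x + m) ^+ k * _]mulrA [RHS]mulrAC.
  congr (_ * _).
  have := mulfV (lt0r_neq0 x0); rewrite !exprS.
  set u := x^-1; set l := ln x; set y := x ^+ k; set s := (x + m) ^+ k.
  set P := k.+1%:R => xV.
  have := congr1 (fun t => t * (P * l * s * (1 + m * y))) xV => /=.
  by lra.
have scdE : single_crossing dE.
  apply: single_crossingM; last exact: single_crossing_log.
  move=> x x1.
  have x0 : 0 < x by rewrite (lt_trans _ x1).
  by rewrite divr_gt0 ?mulr_gt0 ?exprn_gt0 ?xm0 ?D0.
have AE (x : R) : 1 < x ->
    A x = (t - E x) * ((x ^+ k.+1 - 1) / (x + m) ^+ k.+1).
  move=> x1; rewrite /A /E.
  have xmN0 : (x + m) ^+ k.+1 != 0 by rewrite expf_neq0// gt_eqF ?xm0.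
  by rewrite mulrBl !mulrA divfK ?gt_eqF ?D0// mulfK.
have E0 (x : R) : 1 < x -> 0 < (x ^+ k.+1 - 1) / (x + m) ^+ k.+1.
  by move=> x1; rewrite divr_gt0 ?D0// exprn_gt0 ?xm0.
have Et (x : R) : 1 < x -> A x = 0 -> E x = t.
  move=> x1; rewrite AE// => /eqP; rewrite mulf_eq0 (gt_eqF (E0 _ x1)) orbF.
  by rewrite subr_eq0 => /eqP.
have [|x /andP[x1 x2]] := is_derive1_MVT z12 (df := dE) (f := E).
  by move=> x /andP[x1 _]; apply: dEx; apply: lt_le_trans x1.
rewrite !Et// subrr => /esym/eqP; rewrite mulf_eq0 subr_eq0 (gt_eqF z12) orbF.
move=> /eqP dEx0.
have [|y /andP[y1 y2] Ey] := is_derive1_MVT zz1 (df := dE) (f := E).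
  by move=> y /andP[y1 _]; apply: dEx; apply: lt_le_trans y1.
have dEy : dE y < 0.
  rewrite ltNge; apply/negP => /scdE -/(_ x); rewrite dEx0 ltxx.
  move=> h; suff : false by [].
  by apply: h; [apply: lt_trans y1 | apply: lt_trans x1].
rewrite AE// pmulr_llt0 ?E0// subr_lt0 -(Et z1)// -subr_lt0 Ey.
by rewrite nmulr_rlt0// subr_gt0.
Qed.

End ratio.

(** * The finite-dimensional problem *)

Section xlnx.
Variable R : realType.

(** The delicate point is 0. On its left [ln] is 0; on its right put [s = sqrt y]. Then
    [ln s^-1 < s^-1] gives [|y ln y| < 2 s], which explains the radius [(e / 2) ^+ 2]. *)
Lemma continuous_xlnx : continuous (fun x : R => x * ln x).
Proof.
move=> x; have [x0|x0|->] := ltgtP x 0.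
- apply: cvg_near_cst; near=> y; rewrite (ln0 (ltW x0)) ln0 ?mulr0//.
  by apply: ltW; near: y; exact: lt_nbhsl.
- by apply: continuousM; [exact: cvg_id | exact: continuous_ln].
- rewrite /continuous_at/= mul0r; apply/cvgr0Pnorm_lt => e e0.
  near=> y; have [y0|y0] := leP y 0; first by rewrite ln0// mulr0 normr0.
  have y1 : y < 1 by near: y; exact: lt_nbhsl.
  have ye : y < (e / 2) ^+ 2.
    by near: y; apply: lt_nbhsl; rewrite exprn_gt0// divr_gt0.
  set s := Num.sqrt y; have s0 : 0 < s by rewrite sqrtr_gt0.
  have yE : y = s * s by rewrite -expr2 sqr_sqrtr// ltW.
  have lns : - s^-1 < ln s.
    rewrite ltrNl -lnV ?posrE//; apply: ln_sublinear; rewrite invr_gt0//.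
  have lnE : ln y = ln s + ln s by rewrite yE lnM ?posrE.
  rewrite ler0_norm; last by rewrite pmulr_rle0// ln_le0// ltW.
  have se : s < e / 2.
    rewrite -(@ltr_pXn2r _ 2) ?nnegrE ?(ltW s0) ?divr_ge0 ?(ltW e0)//.
    by rewrite expr2 -yE.
  have : y * - s^-1 < y * ln s by rewrite ltr_pM2l.
  by rewrite mulrN [in X in X < _ -> _]yE mulfK ?gt_eqF// lnE; lra.
Unshelve. all: by end_near. Qed.

End xlnx.

(** * The objective on the simplex and existence of its maximizers *)

Section simplex_objective.
Variables (R : realType) (c v : nat).
Implicit Types (theta : R) (x : 'rV[R]_c).

Definition simplex_obj_term theta (t : R) := theta * t ^+ v - t * ln t.

(** The functional at the constant function [x], up to the term [- ln c]; see [objective_cst]. *)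
Definition simplex_obj theta x := \sum_(r < c) simplex_obj_term theta (x 0 r).

Definition simplex_max theta x :=
  simplex x /\
  forall y, simplex y -> simplex_obj theta y <= simplex_obj theta x.

Lemma continuous_simplex_obj_term theta : continuous (simplex_obj_term theta).
Proof.
move=> t; apply: cvgB; last exact: continuous_xlnx.
by apply: cvgM; [exact: cvg_cst | exact: exprn_continuous].
Qed.

Lemma continuous_sum_coord (h : R -> R) : continuous h ->
  continuous (fun x : 'rV[R]_c => \sum_(r < c) h (x 0 r)).
Proof.
move=> ch; rewrite (_ : (fun x => _) =
    \sum_(r < c) (fun x : 'rV[R]_c => h (x 0 r))); last first.
  by apply/funext => x; rewrite fct_sumE.
elim/big_ind : _ => [|f g cf cg|r _] x.
- exact: (@cst_continuous _ _ (0 : R)).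
- by apply: continuousD; [exact: cf | exact: cg].
- apply: (@continuous_comp _ _ _ (fun x : 'rV[R]_c => x 0 r)).
    exact: coord_continuous.
  exact: ch.
Qed.

Lemma continuous_simplex_obj theta : continuous (simplex_obj theta).
Proof. exact/continuous_sum_coord/continuous_simplex_obj_term. Qed.

Lemma simplex_objE theta x : simplex_obj theta x =
  theta * \sum_(r < c) x 0 r ^+ v - \sum_(r < c) x 0 r * ln (x 0 r).
Proof. by rewrite mulr_sumr -sumrB. Qed.

Lemma simplex_compact : compact (@simplex R c).
Proof.
apply: bounded_closed_compact.
  exists 1; split=> // M M1 x [x01 _]; apply: le_trans (ltW M1).
  rewrite [leLHS]/Num.Def.normr /= mx_normrE; apply/bigmax_leP.
  split=> // -[i j] _ /=.
  by have /andP[x0 x1] := x01 j; rewrite ord1 ger0_norm.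
rewrite (_ : @simplex R c = (\bigcap_(r in [set: 'I_c])
    ((fun x : 'rV[R]_c => x 0 r) @^-1` `[0, 1]%classic)) `&`
    (fun x : 'rV[R]_c => \sum_(r < c) x 0 r) @^-1` [set 1]).
  apply: closedI.
    apply: closed_bigI => r _; apply: preimage_closed => [x _|].
      exact: coord_continuous.
    exact: interval_closed.
  apply: preimage_closed => [x _|]; last exact: closed_eq.
  by apply: (@continuous_sum_coord id) => y; exact: cvg_id.
apply/seteqP; split=> x [x01 x1]; split=> // r; first by move=> _; exact: x01.
by have := x01 r Logic.I; rewrite /= in_itv.
Qed.

Lemma uniform_vec_simplex : (0 < c)%N -> simplex (uniform_vec R c).
Proof.
move=> c0; split=> [r|].
  by rewrite mxE invr_ge0 ler0n invf_le1 ?ltr0n// ler1n.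
under eq_bigr do rewrite mxE.
by rewrite sumr_const card_ord -[LHS]mulr_natl divff// pnatr_eq0 -lt0n.
Qed.

Lemma simplex_max_exists theta : (0 < c)%N -> exists x, simplex_max theta x.
Proof.
move=> c0; have [||x xS xmax] :=
    @EVT_max_rV R c (simplex_obj theta) (@simplex R c) _ simplex_compact.
- by exists (uniform_vec R c); exact: uniform_vec_simplex.
- exact/continuous_subspaceT/continuous_simplex_obj.
by exists x; split=> [|y yS]; [rewrite inE in xS | apply: xmax; rewrite inE].
Qed.

End simplex_objective.

(** * First and second order conditions at a maximizer on the simplex *)

Section maximizer_shape.
Variables (R : realType) (c k : nat) (theta : R).
Hypothesis theta0 : 0 <= theta.
Implicit Types (x : 'rV[R]_c) (i j r : 'I_c) (t s : R).

Local Notation v := k.+2.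
Local Notation h := (simplex_obj_term v theta).
Local Notation Phi := (@simplex_obj R c v theta).
Local Notation Phi_max := (@simplex_max R c v theta).

(** This is [h' + 1], whose common value at all coordinates is the Lagrange condition on the
    simplex. *)
Definition stationarity t := theta * v%:R * t ^+ k.+1 - ln t.
Local Notation g := stationarity.

Lemma simplex_coord_ge0 x r : simplex x -> 0 <= x 0 r.
Proof. by case=> /(_ r) /andP[]. Qed.

Lemma simplex_coord_le1 x r : simplex x -> x 0 r <= 1.
Proof. by case=> /(_ r) /andP[]. Qed.

(** Moving mass between two coordinates stays in the simplex. The positivity, stationarity and
    second order arguments below all test maximality by such moves. *)
Lemma simplex_max_transfer x i j t : Phi_max x -> i != j ->
  0 <= t <= x 0 i + x 0 j ->
  h t + h (x 0 i + x 0 j - t) <= h (x 0 i) + h (x 0 j).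
Proof.
move=> [[x01 x1] xmax] ij /andP[t0 ts].
have ji : j != i by rewrite eq_sym.
pose y : 'rV[R]_c := \row_r
  (if r == i then t else if r == j then x 0 i + x 0 j - t else x 0 r).
(* [F] is kept general: the identity gives the mass constraint, and [h] the change of the
   objective. *)
have E (F : R -> R) : \sum_(r < c) F (y 0 r) - \sum_(r < c) F (x 0 r) =
    F t + F (x 0 i + x 0 j - t) - F (x 0 i) - F (x 0 j).
  rewrite (bigD1 i)//= (bigD1 j)//= [X in _ - X](bigD1 i)//=.
  rewrite [X in _ - (_ + X)](bigD1 j)//= !mxE !eqxx (negbTE ji).
  rewrite (eq_bigr (fun r => F (x 0 r))); first by lra.
  by move=> r /andP[/negbTE ri /negbTE rj]; rewrite mxE ri rj.
have xij : x 0 i + x 0 j <= 1.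
  rewrite -x1 (bigD1 i)//= (bigD1 j)//= addrA lerDl.
  by apply: sumr_ge0 => r _; have /andP[] := x01 r.
have /xmax : simplex y; last by rewrite -subr_le0 E; lra.
split=> [r|]; last by have := E id; rewrite x1 /=; lra.
rewrite mxE; case: ifP => _; first by apply/andP; split; lra.
case: ifP => _ //; apply/andP; split; lra.
Qed.

(** The power term loses at most linearly in the transferred mass [t], whereas near 0 the entropy
    gains [- t ln t]. *)
Lemma expr_shift_ge n s t : 0 <= t <= s -> s <= 1 ->
  s ^+ n - (s - t) ^+ n <= n%:R * t.
Proof.
move=> /andP[t0 ts] s1; elim: n => [|n IH]; first by rewrite !expr0 mul0r subrr.
have st : 0 <= (s - t) ^+ n <= 1.
  by rewrite exprn_ge0 ?exprn_ile1//=; lra.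
have [sn|sn] := leP 0 (s ^+ n - (s - t) ^+ n).
  have : s * (s ^+ n - (s - t) ^+ n) <= 1 * (s ^+ n - (s - t) ^+ n).
    exact: ler_wpM2r.
  have : t * (s - t) ^+ n <= t * 1 by apply: ler_wpM2l => //; case/andP: st.
  by rewrite !exprS -addn1 natrD; lra.
have : s ^+ n >= (s - t) ^+ n.
  by apply: lerXn2r; rewrite ?nnegrE; lra.
by lra.
Qed.

Lemma simplex_max_gt0 x r : Phi_max x -> 0 < x 0 r.
Proof.
move=> xmax; have [xS _] := xmax.
rewrite lt_neqAle simplex_coord_ge0// andbT; apply/negP => /eqP xr.
have [j xj] : exists j, 0 < x 0 j.
  apply/not_existsP => xle; have := xS.2; rewrite big1 => [/esym/eqP|j _].
    by rewrite oner_eq0.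
  apply/eqP; rewrite eq_le simplex_coord_ge0// andbT leNgt; exact/negP/xle.
have rj : r != j by apply/eqP => rj; rewrite -rj -xr ltxx in xj.
set s := x 0 j in xj *; have s1 : s <= 1 by exact: simplex_coord_le1.
(* This [t] satisfies [ln t <= ln s - theta v - 1]. The entropy gain then beats the loss [theta v t]
   of the power term, with net gain at least [t]. *)
pose t := Num.min s (expR (ln s - theta * v%:R - 1)).
have t0 : 0 < t by rewrite lt_min xj expR_gt0.
have ts : t <= s by rewrite ge_min lexx.
have lnt : ln t <= ln s - theta * v%:R - 1.
  rewrite -[leRHS]expRK ler_ln ?posrE ?expR_gt0//.
  by rewrite ge_min lexx orbT.
have := simplex_max_transfer xmax rj (t := t); rewrite -xr -/s add0r.
move=> /(_ _)/wrap[]; first by rewrite ts ltW.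
rewrite /simplex_obj_term expr0n/= mulr0 mul0r subrr add0r; apply/negP.
rewrite -ltNge.
have st : (s - t) * ln (s - t) <= (s - t) * ln s.
  have [st|st] := ltP t s; last first.
    by have -> : t = s; [apply/le_anti; rewrite ts | rewrite subrr !mul0r].
  by rewrite ler_wpM2l ?ler_ln ?posrE; lra.
have tl : t * ln t <= t * (ln s - theta * v%:R - 1) by rewrite ler_wpM2l// ltW.
have : theta * (s ^+ v - (s - t) ^+ v) <= theta * (v%:R * t).
  by rewrite ler_wpM2l// expr_shift_ge// ts ltW.
have : 0 <= theta * t ^+ v by rewrite mulr_ge0// exprn_ge0// ltW.
set a := s ^+ v; set b := (s - t) ^+ v; set d := t ^+ v; set n := v%:R in tl *.
lra.
Qed.

Lemma is_derive_transfer s t : 0 < t -> t < s ->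
  is_derive t 1 (fun t => h t + h (s - t)) (g t - g (s - t)).
Proof.
move=> t0 ts; have st0 : 0 < s - t by rewrite subr_gt0.
rewrite /simplex_obj_term; apply: is_derive_eq; first by derive_pointwise.
rewrite /g /=; have := mulfV (lt0r_neq0 t0); have := mulfV (lt0r_neq0 st0).
set n := v%:R; set a := t ^+ _; set b := (s - t) ^+ _; set u := t^-1.
by set w := (s - t)^-1; lra.
Qed.

(** Both coordinates being positive, the transfer between them has its maximum at an interior point,
    where its derivative vanishes. *)
Lemma simplex_max_stationary x i j : Phi_max x -> g (x 0 i) = g (x 0 j).
Proof.
move=> xmax; have [->//|ij] := eqVneq i j.
have xi := simplex_max_gt0 i xmax; have xj := simplex_max_gt0 j xmax.
set s := x 0 i + x 0 j.
have s0 : 0 < s by rewrite addr_gt0.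
have si : x 0 i \in `]0, s[%R by rewrite in_itv/= xi ltrDl.
have D : is_derive (x 0 i) 1 (fun t => h t + h (s - t)) 0.
  apply: (derive1_at_max (ltW s0)) si _ => t; rewrite in_itv/= => /andP[t0 ts].
    by have [] := is_derive_transfer t0 ts.
  have := simplex_max_transfer xmax ij (t := t); rewrite -/s.
  have -> : s - x 0 i = x 0 j by rewrite /s; lra.
  by apply; rewrite !ltW.
have := is_derive_transfer xi (s := s).
rewrite ltrDl => /(_ xj) D'; have := @derive_val _ _ _ _ _ _ _ D'.
rewrite (@derive_val _ _ _ _ _ _ _ D).
have -> : s - x 0 i = x 0 j by rewrite /s; lra.
by move/esym/eqP; rewrite subr_eq0 => /eqP.
Qed.

Lemma is_derive_stationarity t : 0 < t ->
  is_derive t 1 g ((theta * v%:R * k.+1%:R * t ^+ k.+1 - 1) / t).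
Proof.
move=> t0; apply: is_derive_eq; first by rewrite /g; derive_pointwise.
have := mulfV (lt0r_neq0 t0); rewrite /= exprS.
set n := v%:R; set p := k.+1%:R; set a := t ^+ _; set u := t^-1 => tu.
by have := congr1 (fun e => e * (theta * n * p * a)) tu => /=; lra.
Qed.

(** Rolle's theorem: the equation on [u] says that [g' u = 0], so [u] is the turning point between
    the two branches of [g]. *)
Lemma stationarity_eq_turn s t : 0 < s -> s < t -> g s = g t ->
  exists2 u, s < u < t & theta * v%:R * k.+1%:R * u ^+ k.+1 = 1.
Proof.
move=> s0 st gst.
have [|u /andP[su ut]] := is_derive1_MVT st (f := g)
    (df := fun t => (theta * v%:R * k.+1%:R * t ^+ k.+1 - 1) / t).
  by move=> u /andP[su _]; apply: is_derive_stationarity; apply: lt_le_trans su.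
rewrite gst subrr => /esym/eqP; rewrite !mulf_eq0 invr_eq0 subr_eq0.
rewrite [t - s == 0]subr_eq0 (gt_eqF st) (gt_eqF (lt_trans s0 su)) !orbF.
move=> /eqP ?.
by exists u; rewrite ?su.
Qed.

Lemma stationarity_lt u s t : 0 < u -> theta * v%:R * k.+1%:R * u ^+ k.+1 = 1 ->
  u <= s -> s < t -> g s < g t.
Proof.
move=> u0 uE us st; rewrite -subr_gt0.
have [|w /andP[sw wt] ->] := is_derive1_MVT st (f := g)
    (df := fun t => (theta * v%:R * k.+1%:R * t ^+ k.+1 - 1) / t).
  move=> w /andP[sw _]; apply: is_derive_stationarity.
  by apply: lt_le_trans u0 (le_trans us sw).
have uw : u < w by apply: le_lt_trans sw.
have w0 : 0 < w by apply: lt_trans uw.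
apply: mulr_gt0; last by rewrite subr_gt0.
apply: divr_gt0; rewrite // subr_gt0 -[ltLHS]uE.
rewrite ltr_pM2l ?ltrXn2r ?nnegrE ?ltW//.
by rewrite -(pmulr_lgt0 _ (exprn_gt0 k.+1 u0)) uE.
Qed.

(* Two equal coordinates cannot sit where [stationarity] increases, since
   there transferring mass between them increases the objective. *)
Lemma simplex_max_eq_coord x i j u : Phi_max x -> i != j -> x 0 i = x 0 j ->
  0 < u -> u < x 0 i -> theta * v%:R * k.+1%:R * u ^+ k.+1 = 1 -> False.
Proof.
move=> xmax ij xij u0 ux uE; set b := x 0 i in ux.
have b0 : 0 < b by exact: simplex_max_gt0.
(* The first bound keeps [b + b - t] positive and the second keeps it above [u], so both coordinates
   remain on the increasing branch. *)
pose t := Num.min (b + b / 2) (b + (b - u) / 2).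
have bt : b < t by rewrite lt_min; apply/andP; split; lra.
have t1 : t <= b + b / 2 by rewrite ge_min lexx.
have t2 : t <= b + (b - u) / 2 by rewrite ge_min lexx orbT.
have := simplex_max_transfer xmax ij (t := t); rewrite -xij -/b.
move=> /(_ _)/wrap[]; first by apply/andP; split; lra.
apply/negP; rewrite -ltNge -subr_gt0.
have [|w /andP[bw wt]] := is_derive1_MVT bt
    (f := fun t => h t + h (b + b - t)) (df := fun t => g t - g (b + b - t)).
  by move=> w /andP[bw wt]; apply: is_derive_transfer; lra.
have -> : b + b - b = b by lra.
move=> ->; rewrite mulr_gt0 ?subr_gt0//.
by apply: (stationarity_lt u0 uE); lra.
Qed.

(** If [x 0 i < x 0 j], stationarity puts the turning point strictly between them, so [x 0 j] and
    [x 0 r] both lie on the increasing branch. They can be neither equal nor distinct there. By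
    symmetry in [i] and [j], all coordinates other than [r] agree. *)
Lemma simplex_max_coord_le x r i j : Phi_max x ->
  (forall j, x 0 j <= x 0 r) -> i != r -> j != r -> x 0 j <= x 0 i.
Proof.
move=> xmax xr ir jr; rewrite leNgt; apply/negP => xij.
have xi := simplex_max_gt0 i xmax.
have [u /andP[iu uj] uE] :=
  stationarity_eq_turn xi xij (simplex_max_stationary i j xmax).
have u0 : 0 < u by apply: lt_trans iu.
have := xr j; rewrite le_eqVlt => /orP[/eqP xjr|xjr].
  exact: (simplex_max_eq_coord xmax jr xjr u0 uj uE).
have := stationarity_lt u0 uE (ltW uj) xjr.
by rewrite (simplex_max_stationary j r xmax) ltxx.
Qed.

(** Two distinct coordinates would enclose a turning point in (0, 1), which the smallness of [theta]
    excludes. *)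
Lemma simplex_max_small x i j : Phi_max x -> theta * v%:R * k.+1%:R < 1 ->
  x 0 i = x 0 j.
Proof.
wlog xij : i j / x 0 i < x 0 j => [H xmax small|xmax].
  by have [xij|xij|//] := ltgtP (x 0 i) (x 0 j); [|apply/esym]; exact: H.
have [u /andP[iu uj] uE] := stationarity_eq_turn
  (simplex_max_gt0 i xmax) xij (simplex_max_stationary i j xmax).
have u0 : 0 < u by apply: lt_trans iu; exact: simplex_max_gt0.
suff : 1 <= theta * v%:R * k.+1%:R by move=> + h; rewrite leNgt h.
rewrite -[leLHS]uE -[leRHS]mulr1 ler_wpM2l ?mulr_ge0// exprn_ile1 ?(ltW u0)//.
by apply: le_trans (ltW uj) _; apply: simplex_coord_le1; case: xmax.
Qed.

End maximizer_shape.

(** * Vectors with one distinguished coordinate *)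

Section spike.
Variables (R : realType) (c k : nat).
Hypothesis hc : (1 < c)%N.
Implicit Types (theta z : R) (x : 'rV[R]_c) (i j r : 'I_c).

Local Notation v := k.+2.
Local Notation m := (c.-1%:R : R).
Local Notation Phi := (@simplex_obj R c v).
Local Notation Phi_max := (@simplex_max R c v).

Let m1 : 1 <= m.
Proof. by rewrite ler1n; case: c hc => [|[]]. Qed.

Let cE : c%:R = 1 + m.
Proof. by rewrite -[1]/(1%:R) -natrD add1n prednK// ltnW. Qed.

(* [z] is the ratio between the distinguished coordinate [r] and the others. *)
Definition spike r z : 'rV[R]_c :=
  \row_j ((if j == r then z else 1) / (z + m)).

Lemma spike_denom_gt0 z : 1 <= z -> 0 < z + m.
Proof. by move: m1; lra. Qed.

Lemma spike1 r : spike r 1 = uniform_vec R c.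
Proof. by apply/rowP => j; rewrite !mxE if_same div1r cE. Qed.

Lemma sum_spike r z (F : R -> R) :
  \sum_(j < c) F (spike r z 0 j) = F (z / (z + m)) + m * F (z + m)^-1.
Proof.
rewrite (bigD1 r)//= mxE eqxx (eq_bigr (fun=> F (z + m)^-1)).
  by rewrite sumr_const cardC1 card_ord mulr_natl.
by move=> j /negbTE jr; rewrite mxE jr div1r.
Qed.

Lemma spike_simplex r z : 1 <= z -> simplex (spike r z).
Proof.
move=> z1; have zm := spike_denom_gt0 z1; split=> [j|].
  rewrite mxE divr_ge0 ?(ltW zm)//=; last by case: ifP => _; lra.
  by rewrite ler_pdivrMr// mul1r; case: ifP => _; move: m1; lra.
rewrite (sum_spike r z id) /= -mulrDl divff//.
by rewrite gt_eqF.
Qed.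

Lemma spike_lt r j z : 1 < z -> j != r -> spike r z 0 j < spike r z 0 r.
Proof.
move=> z1 /negbTE jr; rewrite !mxE eqxx jr ltr_pM2r// invr_gt0.
exact/spike_denom_gt0/ltW.
Qed.

Definition spike_obj theta z : R :=
  theta * ((z ^+ v + m) / (z + m) ^+ v) - z * ln z / (z + m) + ln (z + m).

Lemma simplex_obj_spike theta r z : 1 <= z ->
  Phi theta (spike r z) = spike_obj theta z.
Proof.
move=> z1; have zm := spike_denom_gt0 z1.
have z0 : 0 < z by apply: lt_le_trans z1.
rewrite /simplex_obj sum_spike /simplex_obj_term /spike_obj.
rewrite ln_div ?posrE// lnV ?posrE// exprMn exprVn.
have := mulfV (lt0r_neq0 zm).
set w := (z + m)^-1; set W := ((z + m) ^+ v)^-1; set l := ln (z + m) => zw.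
by have := congr1 (fun e => e * l) zw; rewrite /=; set a := z ^+ v; lra.
Qed.

(** The bracket is the function [A] of [log_ratio_before_second_root] with [t = theta * v%:R]. *)
Lemma is_derive_spike_obj theta z : 1 <= z ->
  is_derive z 1 (spike_obj theta) (m / (z + m) ^+ 2 *
    (theta * v%:R * (z ^+ k.+1 - 1) / (z + m) ^+ k.+1 - ln z)).
Proof.
move=> z1; have zm := spike_denom_gt0 z1.
have z0 : 0 < z by apply: lt_le_trans z1.
have zmN0 := lt0r_neq0 zm; have zmv := expf_neq0 v zmN0.
rewrite /spike_obj; apply: is_derive_eq; first by derive_pointwise.
have zmp := expf_neq0 k.+1 zmN0.
have zV := mulfV zmN0; have zpV := mulfV zmp; have zzV := mulfV (lt0r_neq0 z0).
rewrite [(z + m) ^+ v]exprS [z ^+ v]exprS /= exprMn !expr2.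
rewrite !invfM.
set w := (z + m)^-1 in zV *; set W := ((z + m) ^+ k.+1)^-1 in zpV *.
set u := z^-1 in zzV *.
set D := (z + m) ^+ k.+1 in zpV *; set a := z ^+ k.+1; set n := v%:R.
have := congr1 (fun e => e * (theta * n * m * (a - 1) * w * w * W)) zpV.
have := congr1 (fun e => e * w) zV.
have := congr1 (fun e => e * w) zzV.
have := congr1 (fun e => e * w * w * z) zzV.
have := congr1 (fun e => e * w * w * m) zzV.
rewrite /=.
lra.
Qed.

Lemma simplex_max_spike theta x r : 0 <= theta -> Phi_max theta x ->
  (forall j, x 0 j <= x 0 r) -> exists2 z, 1 <= z & x = spike r z.
Proof.
move=> theta0 xmax xr.
have [i ir] : exists i, i != r.
  have : (0 < #|predC1 r|)%N by rewrite cardC1 card_ord; case: c hc => [|[]].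
  by case/card_gt0P => i; exists i.
have xi := simplex_max_gt0 theta0 i xmax.
have xE j : j != r -> x 0 j = x 0 i.
  by move=> jr; apply/le_anti; rewrite !(simplex_max_coord_le theta0 xmax xr).
have xsum : x 0 r + m * x 0 i = 1.
  have [[_ xs] _] := xmax; rewrite -[RHS]xs (bigD1 r)//=.
  by rewrite (eq_bigr (fun=> x 0 i))// sumr_const cardC1 card_ord mulr_natl.
exists (x 0 r / x 0 i); first by rewrite ler_pdivlMr// mul1r.
have zm : x 0 r / x 0 i + m = (x 0 i)^-1.
  by rewrite -[m](mulfK (lt0r_neq0 xi)) -mulrDl xsum div1r.
apply/rowP => j; rewrite mxE zm invrK; case: eqVneq => [->|/xE->].
  by rewrite divfK// gt_eqF.
by rewrite mul1r.
Qed.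

(** Stationarity is compared at [r] and at another coordinate; the terms [ln (z + m)] cancel. *)
Lemma spike_max_root theta r z : 0 <= theta -> 1 <= z ->
  Phi_max theta (spike r z) ->
  theta * v%:R * (z ^+ k.+1 - 1) / (z + m) ^+ k.+1 - ln z = 0.
Proof.
move=> theta0 z1 zmax; have zm := spike_denom_gt0 z1.
have z0 : 0 < z by apply: lt_le_trans z1.
have [i ir] : exists i, i != r.
  have : (0 < #|predC1 r|)%N by rewrite cardC1 card_ord; case: c hc => [|[]].
  by case/card_gt0P => i; exists i.
have := simplex_max_stationary theta0 r i zmax.
rewrite /stationarity !mxE eqxx (negbTE ir) ln_div ?posrE// ln_div ?posrE// ln1.
rewrite !exprMn expr1n !exprVn; set W := ((z + m) ^+ k.+1)^-1.
by set a := z ^+ k.+1; set n := v%:R; lra.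
Qed.

(** With [z1 < z2] both roots of the derivative, the objective decreases strictly from 1 to [z1].
    The uniform vector, which is the spike at 1, then beats the one at [z1]. *)
Lemma spike_max_unique theta r z1 z2 : 0 <= theta -> 1 < z1 -> 1 < z2 ->
  Phi_max theta (spike r z1) -> Phi_max theta (spike r z2) -> z1 = z2.
Proof.
move=> theta0; wlog z12 : z1 z2 / z1 < z2 => [H z1_1 z2_1 max1 max2|].
  by have [z12|z12|//] := ltgtP z1 z2; [|apply/esym]; exact: H.
move=> z1_1 z2_1 max1 max2; exfalso.
have r1 := spike_max_root theta0 (ltW z1_1) max1.
have r2 := spike_max_root theta0 (ltW z2_1) max2.
have := max1.2 _ (spike_simplex r (lexx 1)).
rewrite !simplex_obj_spike ?(ltW z1_1)//; apply/negP; rewrite -ltNge -subr_lt0.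
have [|z /andP[z_1 zz1] ->] := is_derive1_MVT z1_1 (f := spike_obj theta)
    (df := fun z => m / (z + m) ^+ 2 *
      (theta * v%:R * (z ^+ k.+1 - 1) / (z + m) ^+ k.+1 - ln z)).
  by move=> z /andP[+ _]; exact: is_derive_spike_obj.
rewrite nmulr_rlt0 ?subr_gt0// pmulr_rlt0.
  exact: (log_ratio_before_second_root m1 z_1 zz1 z12 r1 r2).
rewrite divr_gt0 ?exprn_gt0 ?spike_denom_gt0 ?(ltW z_1)//.
exact: lt_le_trans m1.
Qed.

End spike.

(** Outside a neighbourhood of [x a], compactness and uniqueness leave a gap [d] below the maximum
    at [a]. Since [|P| <= 1], replacing [a] by [t] changes the difference of two values by at most
    [2 * |a - t|], which is less than [d] when [|a - t| < d / 2]. *)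
Lemma continuous_unique_argmax (R : realType) (T : topologicalType) (S : set T)
    (P Q : T -> R) (x : R -> T) (I : set R) (a : R) :
  compact S -> continuous P -> continuous Q ->
  (forall y, S y -> `|P y| <= 1) -> open I -> I a ->
  (forall t, I t -> S (x t) /\
     forall y, S y -> t * P y - Q y <= t * P (x t) - Q (x t)) ->
  (forall y, S y -> a * P y - Q y = a * P (x a) - Q (x a) -> y = x a) ->
  {for a, continuous x}.
Proof.
move=> cS cP cQ P1 oI Ia xmax xuniq U /= /nbhs_interior Ux.
pose F y := a * P y - Q y; pose K := S `&` ~` U°.
have cK : compact K.
  by apply: compact_closedI => //; exact/open_closedC/open_interior.
have [d d0 Kd] : exists2 d, 0 < d & forall y, K y -> F y + d <= F (x a).
  have [K0|/set0P K0] := eqVneq K set0.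
    by exists 1 => // y; rewrite K0.
  have cF : continuous F.
    move=> y; apply: cvgB; last exact: cQ.
    by apply: cvgM; [exact: cvg_cst | exact: cP].
  have [y0 + ymax] := compact_EVT_max K0 cK (continuous_subspaceT cF).
  rewrite inE => -[Sy0 Uy0]; exists (F (x a) - F y0) => [|y Ky].
    rewrite subr_gt0 lt_neqAle (xmax _ Ia).2// andbT; apply/eqP => /xuniq.
    by move=> /(_ Sy0) y0E; apply: Uy0; rewrite y0E; exact: nbhs_singleton.
  by have := ymax y; rewrite inE => /(_ Ky); lra.
suff : \forall t \near a, U (x t) by [].
near=> t; have It : I t by near: t; exact: open_nbhs_nbhs.
have td : `|a - t| < d / 2.
  by near: t; apply: (@cvgr_dist_lt _ _ _ _ _ id) => //; rewrite divr_gt0.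
have [Sxt xtmax] := xmax _ It; apply: interior_subset; apply: contrapT => Uxt.
have := xtmax _ (xmax _ Ia).1; have := Kd _ (conj Sxt Uxt); rewrite /F.
have := P1 _ Sxt; have := P1 _ (xmax _ Ia).1.
move: (P (x a)) (P (x t)) (Q (x a)) (Q (x t)) => p q s u p1 q1 h1 h2.
have pq : `|p - q| <= 2 by rewrite (le_trans (ler_normB _ _))//; lra.
have : (a - t) * (p - q) <= `|a - t| * 2.
  by apply: le_trans (ler_norm _) _; rewrite normrM ler_wpM2l.
by lra.
Unshelve. all: by end_near. Qed.

(** * The critical value of theta *)

Section critical_temperature.
Variables (R : realType) (c k : nat).
Hypothesis hc : (1 < c)%N.
Implicit Types (theta z : R) (x : 'rV[R]_c) (i j r : 'I_c).

Local Notation v := k.+2.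
Local Notation m := (c.-1%:R : R).
Local Notation Phi := (@simplex_obj R c v).
Local Notation Phi_max := (@simplex_max R c v).
Local Notation u := (uniform_vec R c).

Let c0 : (0 < c)%N. Proof. exact: ltnW. Qed.

Lemma simplex_const x : simplex x -> (forall i j, x 0 i = x 0 j) -> x = u.
Proof.
move=> [_ xs] xE; apply/rowP => i; rewrite mxE.
have cn0 : c%:R != 0 :> R by rewrite pnatr_eq0 -lt0n.
apply: (mulfI cn0); rewrite divff// -[RHS]xs.
rewrite (eq_bigr (fun=> x 0 i)) => [|j _//].
by rewrite sumr_const card_ord mulr_natl.
Qed.

Lemma simplex_max_small_uniform theta x : 0 <= theta ->
  theta * v%:R * k.+1%:R < 1 -> Phi_max theta x -> x = u.
Proof.
move=> theta0 small xmax; apply: simplex_const => [|i j]; first by case: xmax.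
exact: simplex_max_small small.
Qed.

Lemma uniform_max_small theta : 0 <= theta ->
  theta * v%:R * k.+1%:R < 1 -> Phi_max theta u.
Proof.
move=> theta0 small; have [x xmax] := @simplex_max_exists R c v theta c0.
by rewrite -(simplex_max_small_uniform theta0 small xmax).
Qed.

(** The objective is affine in [theta], so maximality of the uniform vector at 0 and at [theta']
    passes to [theta]. A vector tied with it at [theta] cannot have a larger slope, or it would win
    at [theta']. Hence it is also maximal at 0, where the maximizer is unique. *)
Lemma uniform_max_subcritical theta theta' x : 0 <= theta -> theta < theta' ->
  Phi_max theta' u -> Phi_max theta x <-> x = u.
Proof.
move=> theta0 tt' umax'.
have umax0 : Phi_max 0 u by apply: uniform_max_small; rewrite ?mul0r.
have umax : Phi_max theta u.
  split=> [|y yS]; first exact: uniform_vec_simplex.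
  have := umax0.2 _ yS; have := umax'.2 _ yS; rewrite !simplex_objE.
  set p := \sum_(r < c) y 0 r ^+ v; set q := \sum_(r < c) u 0 r ^+ v.
  have [pq|/ltW pq] := leP p q.
    by have := ler_wpM2l theta0 pq; lra.
  have : theta * (p - q) <= theta' * (p - q).
    by apply: ler_wpM2r; [rewrite subr_ge0 | exact: ltW].
  by lra.
split=> [xmax|->//]; apply: (@simplex_max_small_uniform 0); rewrite ?mul0r//.
have xS := xmax.1; split=> // y yS; apply: le_trans (umax0.2 _ yS) _.
have := umax.2 _ xS; have := xmax.2 _ umax.1.
have := umax0.2 _ xS; have := umax'.2 _ xS; rewrite !simplex_objE.
set p := \sum_(r < c) x 0 r ^+ v; set q := \sum_(r < c) u 0 r ^+ v.
set a := \sum_(r < c) _ * _; set b := \sum_(r < c) _ * _ => h1 h2 h3 h4.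
have [pq|pq] := leP p q.
  by have := ler_wpM2l theta0 pq; lra.
have : theta * (p - q) < theta' * (p - q) by rewrite ltr_pM2r ?subr_gt0.
by lra.
Qed.

Let U := [set theta | 0 <= theta /\ Phi_max theta u].

Definition critical_theta := sup U.

Lemma has_sup_uniform_max : has_sup U.
Proof.
split; first by exists 0; split=> //; apply: uniform_max_small; rewrite ?mul0r.
(* Compare with a vertex of the simplex, where the objective is [theta]. At the uniform vector it is
   [theta / c ^+ k.+1 + ln c], at most [theta / 2 + ln c]. *)
exists (2 * ln c%:R) => theta [theta0 [_ umax]].
pose r : 'I_c := Ordinal c0.
have cR : 2 <= c%:R :> R by rewrite ler_nat.
have cRgt0 : 0 < c%:R :> R by lra.
pose e : 'rV[R]_c := delta_mx 0 r.
have e1 F : F 0 = 0 -> \sum_(j < c) F (e 0 j) = F 1 :> R.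
  move=> F0; rewrite (bigD1 r)//= mxE !eqxx big1 ?addr0// => j /negbTE jr.
  by rewrite mxE jr andbF F0.
have eS : simplex e.
  split=> [j|]; last exact: (e1 id).
  by rewrite mxE eqxx; case: (j == r); rewrite ?mulr1n ?mulr0n ?lexx ?ler01.
have := umax _ eS; rewrite !simplex_objE.
rewrite (e1 (fun t => t ^+ v)) ?expr0n// expr1n.
rewrite (e1 (fun t => t * ln t)) ?mul0r// ln1 mulr0.
have usum (F : R -> R) : \sum_(j < c) F (u 0 j) = c%:R * F c%:R^-1.
  rewrite (eq_bigr (fun=> F c%:R^-1)) => [|j _]; last by rewrite mxE.
  by rewrite sumr_const card_ord mulr_natl.
rewrite (usum (fun t => t ^+ v)) (usum (fun t => t * ln t)).
have cN0 := lt0r_neq0 cRgt0.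
rewrite exprVn exprS invfM mulVKf// lnV ?posrE// !mulrN mulVKf//.
have : (c%:R ^+ k.+1)^-1 <= 2^-1 :> R.
  rewrite lef_pV2 ?posrE ?exprn_gt0//; apply: (le_trans cR).
  by rewrite exprS ler_peMr ?(ltW cRgt0)// exprn_ege1//; lra.
move=> /(ler_wpM2l theta0); lra.
Qed.

Lemma critical_theta_gt0 : 0 < critical_theta.
Proof.
(* Half of the threshold below which [uniform_max_small] applies. *)
pose t : R := (2 * v%:R * k.+1%:R)^-1.
have n0 : 0 < v%:R * k.+1%:R :> R by rewrite mulr_gt0// ltr0n.
have t0 : 0 < t by rewrite invr_gt0 -mulrA mulr_gt0.
apply: (lt_le_trans t0); apply: (sup_upper_bound has_sup_uniform_max).
split; first exact: ltW.
apply: uniform_max_small; first exact: ltW.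
by rewrite /t -!mulrA invfM mulrAC -mulrA divff ?gt_eqF// mulr1 invf_lt1 ?ltr1n.
Qed.

Lemma subcritical theta x : 0 <= theta -> theta < critical_theta ->
  Phi_max theta x <-> x = u.
Proof.
move=> theta0; rewrite -subr_gt0 => /sup_adherent -/(_ _ has_sup_uniform_max).
rewrite opprB addrC subrK => -[t [t0 tmax] tt].
exact: uniform_max_subcritical tmax.
Qed.

Lemma supercritical theta : critical_theta < theta -> ~ Phi_max theta u.
Proof.
move=> ct umax.
suff /(sup_upper_bound has_sup_uniform_max) : U theta by rewrite leNgt ct.
by split=> //; exact: ltW (lt_trans critical_theta_gt0 ct).
Qed.

Lemma argmax_coord x : exists r, forall j, x 0 j <= x 0 r.
Proof.
pose r0 : 'I_c := Ordinal c0.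
exists [arg max_(r > r0) x 0 r]%O; case: arg_maxP => // r _ rmax j; exact: rmax.
Qed.

Lemma simplex_max_spike_any theta r r' z : 1 <= z ->
  Phi_max theta (spike r z) -> Phi_max theta (spike r' z).
Proof.
move=> z1 [_ zmax]; split=> [|y /zmax]; first exact: spike_simplex.
by rewrite !simplex_obj_spike.
Qed.

(** Every maximizer is a spike at its largest coordinate, with ratio above 1 because the uniform
    vector is excluded. The objective of a spike does not depend on its color, so any two maximizers
    can be moved to the same color, where the ratio is unique. *)
Lemma supercritical_max theta : critical_theta < theta -> exists z, 1 < z /\
  forall x, Phi_max theta x <-> exists r, x = spike r z.
Proof.
move=> ct; have theta0 := ltW (lt_trans critical_theta_gt0 ct).
have spikeE x r : Phi_max theta x -> (forall j, x 0 j <= x 0 r) ->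
    exists2 z, 1 < z & x = spike r z.
  move=> xmax xr; have [z z1 xE] := simplex_max_spike hc theta0 xmax xr.
  exists z => //; rewrite lt_neqAle z1 andbT; apply/eqP => zE.
  by apply: (supercritical ct); rewrite -(spike1 R hc r) zE -xE.
have [x xmax] := @simplex_max_exists R c v theta c0.
have [r xr] := argmax_coord x; have [z z1 xE] := spikeE _ _ xmax xr.
exists z; split=> // y; split=> [ymax|[r' ->]].
  have [r' yr'] := argmax_coord y; have [w w1 yE] := spikeE _ _ ymax yr'.
  exists r'; rewrite yE; congr spike.
  rewrite yE in ymax; rewrite xE in xmax.
  have zmax := simplex_max_spike_any r' (ltW z1) xmax.
  exact: spike_max_unique theta0 w1 z1 ymax zmax.
by move: xmax; rewrite xE; apply: simplex_max_spike_any; exact: ltW.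
Qed.

End critical_temperature.

(** * Form, number and continuity of the maximizers on the simplex *)

Section phase_transition.
Variables (R : realType) (c k : nat).
Hypothesis hc : (1 < c)%N.
Implicit Types (theta z : R) (x : 'rV[R]_c) (i j r : 'I_c).

Local Notation v := k.+2.
Local Notation m := (c.-1%:R : R).
Local Notation Phi_max := (@simplex_max R c v).
Local Notation r0 := (first_color hc).
Local Notation thetac := (critical_theta R c k).

Lemma simplex_max_form theta x : 0 <= theta -> Phi_max theta x ->
  (forall r, r != r0 -> x 0 r <= x 0 r0) ->
  exists y : R, [/\ 0 <= y < 1, x 0 r0 = c%:R^-1 * (1 + (c%:R - 1) * y) &
    forall r, r != r0 -> x 0 r = c%:R^-1 * (1 - y)].
Proof.
move=> theta0 xmax xr.
have [|z z1 ->] := simplex_max_spike hc theta0 xmax (r := r0).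
  by move=> j; have [->//|/xr] := eqVneq j r0.
have m0 : 0 < m by rewrite ltr0n; case: c hc => [|[]].
have cE : c%:R = 1 + m by rewrite -[1]/(1%:R) -natrD add1n prednK// ltnW.
have zm : z + m != 0 by rewrite gt_eqF//; lra.
have cm : 1 + m != 0 by rewrite gt_eqF//; lra.
(* Solution of [(1 - y) / c = 1 / (z + m)] with [c = 1 + m]. *)
exists ((z - 1) / (z + m)); rewrite cE; split.
- rewrite divr_ge0 ?ltr_pdivrMr; lra.
- rewrite mxE eqxx; have := mulfV zm; have := mulfV cm.
  set q := (1 + m)^-1; set w := (z + m)^-1 => qV zV.
  have := congr1 (fun e => e * (z * w)) qV.
  by have := congr1 (fun e => e * q) zV; rewrite /=; lra.
- move=> r /negbTE rr0; rewrite mxE rr0; have := mulfV zm; have := mulfV cm.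
  set q := (1 + m)^-1; set w := (z + m)^-1 => qV zV.
  have := congr1 (fun e => e * w) qV.
  by have := congr1 (fun e => e * q) zV; rewrite /=; lra.
Qed.

Lemma spike_color_inj z i j : 1 < z -> spike i z = spike j z :> 'rV[R]_c ->
  i = j.
Proof.
move=> z1 ij; have [//|ne] := eqVneq i j.
have := spike_lt hc z1 ne; rewrite -ij => /lt_trans.
by rewrite eq_sym in ne; move=> /(_ _ (spike_lt hc z1 ne)); rewrite ltxx.
Qed.

Lemma card_simplex_max theta : thetac < theta ->
  ([set x | Phi_max theta x] #= `I_c)%card.
Proof.
move=> /(supercritical_max hc) [z [z1 zE]].
rewrite (_ : [set x | _] = (fun i => spike i z) @` [set: 'I_c]); last first.
  apply/seteqP; split=> [x /zE [r ->]|x [r _ <-]]; first by exists r.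
  by apply/zE; exists r.
have zinj : {in [set: 'I_c] &, injective (fun i => spike i z : 'rV[R]_c)}.
  by move=> i j _ _; exact: spike_color_inj.
by rewrite (card_eql (inj_card_eq zinj)) card_eq_sym; exact: card_II.
Qed.

Lemma simplex_max_branch : exists xopt : R -> 'rV[R]_c,
  (forall theta, thetac < theta -> forall x, (Phi_max theta x /\
     forall r, r != r0 -> x 0 r < x 0 r0) <-> x = xopt theta) /\
  {within `]thetac, +oo[, continuous xopt}.
Proof.
have /choice[z zP] theta : exists z, thetac < theta -> 1 < z /\
    forall x, Phi_max theta x <-> exists r, x = spike r z.
  (* At or below [thetac] the ratio is a dummy value. *)
  have [tt|tt] := ltP thetac theta; last by exists 0.
  by have [z zP] := supercritical_max hc tt; exists z.
pose xopt theta : 'rV[R]_c := spike r0 (z theta).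
have xmax theta : thetac < theta -> Phi_max theta (xopt theta).
  by move=> /zP[_ zE]; apply/zE; exists r0.
have spikeE theta x : thetac < theta -> Phi_max theta x ->
    (forall r, x 0 r <= x 0 r0) -> x = xopt theta.
  move=> /zP[z1 zE] /zE[r ->] xr; congr spike; apply/eqP.
  apply/negP => /negP rr0; have := xr r; rewrite leNgt.
  by rewrite (spike_lt hc z1)// eq_sym.
exists xopt; split=> [theta tt x|].
  have [z1 _] := zP _ tt; split=> [[xm xr]|->].
    apply: spikeE => // r; have [->//|/xr/ltW//] := eqVneq r r0.
  by split=> [|r rr0]; [exact: xmax | exact: spike_lt].
apply: continuous_in_subspaceT => theta; rewrite inE/= in_itv/= andbT => tt.
(* On the whole simplex there are [c] maximizers; in this compact sector only the one at the first
   color remains. *)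
pose S := [set x : 'rV[R]_c | simplex x /\ forall r, x 0 r <= x 0 r0].
have cS : compact S.
  rewrite (_ : S = @simplex R c `&` \bigcap_(r in [set: 'I_c])
      ((fun x : 'rV[R]_c => x 0 r - x 0 r0) @^-1` [set t | t <= 0])).
    apply: compact_closedI; first exact: simplex_compact.
    apply: closed_bigI => r _; apply: preimage_closed => [x _|].
      exact: (continuousB (@coord_continuous R 1 c 0 r x)
        (@coord_continuous R 1 c 0 r0 x)).
    exact: closed_le.
  apply/seteqP; split=> x [xS xr]; split=> // r.
    by move=> _; rewrite /= subr_le0.
  by have := xr r Logic.I; rewrite /= subr_le0.
apply: (continuous_unique_argmax (S := S) (I := `]thetac, +oo[%classic)
  (P := fun x => \sum_(r < c) x 0 r ^+ v)
  (Q := fun x => \sum_(r < c) x 0 r * ln (x 0 r))) => //.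
- apply: (continuous_sum_coord (h := fun t => t ^+ v)).
  exact: exprn_continuous.
- apply: (continuous_sum_coord (h := fun t => t * ln t)).
  exact: continuous_xlnx.
- move=> x [xS _]; rewrite ger0_norm; last first.
    by apply: sumr_ge0 => r _; rewrite exprn_ge0// (simplex_coord_ge0 r xS).
  rewrite -[leRHS](xS.2); apply: ler_sum => r _.
  rewrite exprS ler_piMr ?exprn_ile1 ?simplex_coord_ge0 ?simplex_coord_le1//.
- by rewrite /= in_itv/= tt.
- move=> t; rewrite /= in_itv/= andbT => ttt; have [xS xm] := xmax _ ttt.
  split=> [|y [yS _]]; last by have := xm _ yS; rewrite !simplex_objE.
  split=> // r; have [->//|rr0] := eqVneq r r0.
  exact/ltW/(spike_lt hc (zP _ ttt).1).
- move=> y [yS yr] yE; apply: spikeE => //; split=> // w wS.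
  by have [_ /(_ _ wS)] := xmax _ tt; rewrite !simplex_objE yE.
Qed.

End phase_transition.

(** * Reduction to constant functions *)

Section cube_measure.
Variable R : realType.
Local Notation I := (measurableTypeR R).
Local Notation mu := (leb01 R).
Local Notation mun := (leb01n R).

Definition perm_tuple n (s : {perm 'I_n}) (t : n.-tuple I) : n.-tuple I :=
  [tuple tnth t (s i) | i < n].

Lemma measurable_perm_tuple n (s : {perm 'I_n}) :
  measurable_fun setT (perm_tuple s).
Proof.
apply/measurable_fun_tnthP => i.
rewrite (_ : _ \o _ = fun t => tnth t (s i)); first exact: measurable_tnth.
by apply/funext => t; rewrite /= tnth_mktuple.
Qed.

HB.instance Definition _ n (s : {perm 'I_n}) :=
  isMeasurableFun.Build _ _ _ _ (perm_tuple s) (measurable_perm_tuple s).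

Lemma measurable_box n (A : 'I_n -> set I) : (forall i, measurable (A i)) ->
  measurable [set t : n.-tuple I | forall i, A i (tnth t i)].
Proof.
move=> mA; rewrite (_ : [set _ | _] =
    \bigcap_(i in [set: 'I_n]) ((fun t => tnth t i) @^-1` A i)).
  apply: fin_bigcap_measurable => // i _.
  by rewrite -[X in measurable X]setTI; exact: measurable_tnth.
by apply/seteqP; split=> t /= h i; [move=> _; exact: h | exact: (h i Logic.I)].
Qed.

(** Boxes are stable under intersection and [leb01n_box] gives their measure, as the uniqueness
    theorem for measures requires. A coordinate preimage is a box with all other sides full. *)
Lemma measurable_tuple_boxes n : @measurable _ (n.-tuple I) =
  <<s [set [set t | forall i, A i (tnth t i)] |
       A in [set A : 'I_n -> set I | forall i, measurable (A i)]] >>.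
Proof.
apply/seteqP; split; last first.
  apply: smallest_sub; first exact: sigma_algebra_measurable.
  by move=> _ [A mA <-]; exact: measurable_box.
apply: smallest_sub; first exact: smallest_sigma_algebra.
rewrite -bigcup_seq => B [i _ [C mC <-]]; apply: sub_sigma_algebra.
exists (fun j => if j == i then C else setT).
  by move=> j; case: ifP.
apply/seteqP; split=> t /=.
  by move=> /(_ i); rewrite eqxx.
by move=> [_ Ct] j; case: ifP => // /eqP ->.
Qed.

(** On a box the permutation only reorders the factors of the volume; boxes determine the
    measure. *)
Lemma leb01n_perm n (s : {perm 'I_n}) (A : set (n.-tuple I)) : measurable A ->
  mun n (perm_tuple s @^-1` A) = mun n A.
Proof.
move=> mA; rewrite -[LHS]/(distribution (mun n) (perm_tuple s) A).
apply: (@measure_unique _ _ _ _ (fun=> setT) (measurable_tuple_boxes n)) => //.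
- move=> _ _ [A1 mA1 <-] [A2 mA2 <-]; exists (fun i => A1 i `&` A2 i).
    by move=> i; exact: measurableI.
  apply/seteqP; split=> t /=; first by move=> h; split=> i; case: (h i).
  by move=> [h1 h2] i; split.
- by move=> _; exists (fun=> setT) => //; apply/seteqP; split.
- by rewrite bigcup_const//; exists 0%N.
- move=> _ [B mB <-]; apply: etrans (esym (leb01n_box mB)).
  rewrite -[LHS]/(mun n _).
  rewrite (_ : _ @^-1` _ = [set t | forall i, B ((s^-1)%g i) (tnth t i)]).
    rewrite (@leb01n_box _ _ (fun i => B ((s^-1)%g i)))//.
    rewrite (reindex_inj (@perm_inj _ s)).
    by apply: eq_bigr => i _; rewrite permK.
  apply/seteqP; split=> t /= h i.
    by have := h ((s^-1)%g i); rewrite tnth_mktuple permKV.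
  by rewrite tnth_mktuple; have := h (s i); rewrite permK.
- by move=> k; rewrite [X in (X < _)%E]probability_setT ltry.
Qed.

Lemma leb01n_tnth n (i : 'I_n) (A : set I) : measurable A ->
  mun n ((fun t => tnth t i) @^-1` A) = mu A.
Proof.
move=> mA; rewrite (_ : _ @^-1` _ = [set t : n.-tuple I |
    forall j, (if j == i then A else setT) (tnth t j)]); last first.
  apply/seteqP; split=> t /=.
    by move=> At j; case: ifP => // /eqP ->.
  by move=> /(_ i); rewrite eqxx.
pose B j := if j == i then A else setT.
rewrite (@leb01n_box _ _ B) /B => [|j]; last by case: ifP.
rewrite (bigD1 i)//= eqxx big1 ?mule1// => j /negbTE ->.
exact: probability_setT.
Qed.

Lemma ae_leb01n_tnth n (P : I -> Prop) : {ae mu, forall x, P x} ->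
  {ae mun n, forall t, forall i, P (tnth t i)}.
Proof.
move=> [N [mN N0 PN]]; apply: filter_forall => i.
exists ((fun t : n.-tuple I => tnth t i) @^-1` N); split.
- by rewrite -[X in measurable X]setTI; exact: measurable_tnth.
- by rewrite leb01n_tnth.
- by move=> t; exact: PN.
Qed.

End cube_measure.

Lemma integrable_distribution d d' (T : measurableType d)
    (T' : measurableType d') (R : realType) (P : probability T R)
    (X : {mfun T >-> T'})
    (f : T' -> \bar R) :
  measurable_fun [set: T'] f ->
  (distribution P X).-integrable setT f <-> P.-integrable setT (f \o X).
Proof.
move=> mf; have mfX : measurable_fun [set: T] (f \o X).
  exact: measurableT_comp.
have E : (\int[distribution P X]_y `|f y| = \int[P]_x `|(f \o X) x|)%E.
  rewrite ge0_integral_distribution//; exact: measurableT_comp.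
by split=> /integrableP[_ fi]; apply/integrableP; split=> //; rewrite ?E// -E.
Qed.

(** * Fubini, permutation of variables and the unit degree condition *)

Section cube_integrals.
Variable R : realType.
Local Notation I := (measurableTypeR R).
Local Notation mu := (leb01 R).
Local Notation mun := (leb01n R).

Lemma ae_leb01_ex (P : I -> Prop) : {ae mu, forall x, P x} -> exists x, P x.
Proof.
move=> muP; have : ProperFilter (almost_everywhere mu).
  apply: ae_properfilter_algebraOfSetsType.
  by rewrite [X in (_ < X)%E](@probability_setT _ _ _ mu) lte01.
by move=> ?; exact: filter_ex muP.
Qed.

(* By Fubini the equation holds for one fixed [t_0] and almost every [t_1]. *)
Lemma ae_leb01n_swap_const n (phi : I -> R) : measurable_fun setT phi ->
  {ae mun n.+2, forall t, phi (tnth t ord0) = phi (tnth t (lift ord0 ord0))} ->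
  exists y, {ae mu, forall x, phi x = y}.
Proof.
move=> mphi [N [mN N0 phiN]].
pose B := tuple_cons (T := I) (n := n.+1) @^-1` N.
have mB : measurable B by rewrite -[B]setTI; exact: measurable_tuple_cons.
have intB : (\int[mu]_x `|mun n.+1 (xsection B x)| = 0)%E.
  rewrite -[RHS]N0 -[RHS]/(product_measure1 mu (mun n.+1) B).
  by apply: eq_integral => x _; rewrite gee0_abs.
(* The exceptional set has null sections at almost every first coordinate; one such [x] is fixed,
   and [phi x] is the constant. *)
have /ae_leb01_ex[x Bx] : {ae mu, forall x, mun n.+1 (xsection B x) = 0%E}.
  have /ae_eq_integral_abs : measurable_fun setT (mun n.+1 \o xsection B).
    exact: measurable_fun_xsection.
  move=> /(_ mu measurableT)[+ _] => /(_ intB); apply: filterS => x; exact.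
exists (phi x); exists (phi @^-1` [set~ phi x]); split.
- by rewrite -[X in measurable X]setTI; apply: mphi => //; exact: measurableC.
- rewrite -(leb01n_tnth (@ord0 n)); last first.
    by rewrite -[X in measurable X]setTI; apply: mphi => //; exact: measurableC.
  apply: (subset_measure0 _ _ _ Bx).
  + rewrite -[X in measurable X]setTI; apply: measurable_tnth => //.
    by rewrite -[X in measurable X]setTI; apply: mphi => //; exact: measurableC.
  + exact: measurable_xsection.
  + move=> t /= tx; rewrite /xsection/= inE; apply: phiN => /= E; apply: tx.
    by move: E; rewrite /tuple_cons tnth0 tnthS => ->.
- by move=> u.
Qed.

Lemma integrable_perm_tuple n (s : {perm 'I_n}) (f : n.-tuple I -> \bar R) :
  (mun n).-integrable setT f ->
  (distribution (mun n) (perm_tuple s)).-integrable setT f.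
Proof.
move=> /integrableP[mf fi]; apply/integrableP; split=> //.
rewrite (eq_measure_integral (mun n))// => A mA _; exact: leb01n_perm.
Qed.

Lemma integral_perm_tuple n (s : {perm 'I_n}) (f : n.-tuple I -> \bar R) :
  (mun n).-integrable setT f ->
  (\int[mun n]_t f (perm_tuple s t) = \int[mun n]_t f t)%E.
Proof.
move=> fi; have mf := measurable_int _ fi.
rewrite [RHS](eq_measure_integral (distribution (mun n) (perm_tuple s))).
  rewrite integral_distribution//; apply/integrable_distribution => //.
  exact: integrable_perm_tuple.
by move=> A mA _; exact/esym/leb01n_perm.
Qed.

Lemma integrable_mulr n (W h : n.-tuple I -> R) :
  (mun n).-integrable setT (EFin \o W) -> measurable_fun setT h ->
  (forall t, `|h t| <= 1) ->
  (mun n).-integrable setT (fun t => (W t * h t)%:E).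
Proof.
move=> Wi mh h1; apply: (integrableMl measurableT Wi mh).
by exists 1; split=> // M M1 t _ /=; apply: le_trans (ltW M1).
Qed.

(** By Fubini, with the first variable outermost, [h x] leaves the inner integral, and what remains
    is [Vdeg W x = 1]. *)
Lemma integral_regular n (W : n.+1.-tuple I -> R) (h : I -> R) :
  (mun n.+1).-integrable setT (EFin \o W) ->
  {ae mu, forall x, Vdeg W x = 1} ->
  measurable_fun setT h -> (forall x, `|h x| <= 1) ->
  (\int[mun n.+1]_t (W t * h (tnth t ord0))%:E = \int[mu]_x (h x)%:E)%E.
Proof.
move=> Wi W1 mh h1.
have mW := measurable_int _ Wi.
have mh0 : measurable_fun setT (fun t : n.+1.-tuple I => h (tnth t ord0)).
  by apply: (measurableT_comp mh); exact: measurable_tnth.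
have Whi := integrable_mulr Wi mh0 (fun t => h1 (tnth t ord0)).
have mWh := measurable_int _ Whi.
have WhXi := (integrable_distribution _ _ mWh).1 Whi.
have WXi := (integrable_distribution _ _ mW).1 Wi.
rewrite [LHS]integral_distribution// -integral12_prod_meas1//.
apply: ae_eq_integral => //.
- exact: (measurable_fubini_F WhXi).
- exact: measurableT_comp.
- have := ae_integrable1 WXi; move: W1; apply: filterS2 => x Wx1 Wxi _.
  transitivity (\int[mun n]_y ((W (tuple_cons (x, y)))%:E * (h x)%:E))%E.
    by apply: eq_integral => y _; rewrite /= /tuple_cons tnth0 EFinM.
  rewrite integralZr// -[RHS]mul1e; congr (_ * _)%E.
  rewrite -[LHS]fineK; last exact: integrable_fin_num.
  congr EFin; rewrite -Wx1 /Vdeg /Rintegral; congr fine.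
  apply: eq_integral => y _ /=; congr (W _)%:E; apply: eq_from_tnth => i.
  by rewrite tnth_mktuple (tnth_nth 0).
Qed.

(** The transposition of [ord0] and [i] preserves the measure and, almost everywhere, [W]; this
    reduces to the first variable. *)
Lemma integral_regular_tnth n (W : n.+1.-tuple I -> R) (h : I -> R) i :
  Wspace W -> {ae mu, forall x, Vdeg W x = 1} ->
  measurable_fun setT h -> (forall x, `|h x| <= 1) ->
  (\int[mun n.+1]_t (W t * h (tnth t i))%:E = \int[mu]_x (h x)%:E)%E.
Proof.
move=> [Wi Wsym] W1 mh h1; rewrite -(integral_regular Wi)//.
have mhi j : measurable_fun setT (fun t : n.+1.-tuple I => h (tnth t j)).
  by apply: (measurableT_comp mh); exact: measurable_tnth.
have Whi j := integrable_mulr Wi (mhi j) (fun t => h1 (tnth t j)).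
pose s := tperm ord0 i.
rewrite -[RHS](integral_perm_tuple s (Whi ord0)).
have mWhs : measurable_fun setT (fun t =>
    (W (perm_tuple s t) * h (tnth (perm_tuple s t) ord0))%:E).
  apply: (measurableT_comp (measurable_int _ (Whi ord0))).
  exact: measurable_perm_tuple.
apply: ae_eq_integral => //; first exact: measurable_int (Whi i).
apply: filterS (Wsym s) => t Wst _.
by rewrite Wst tnth_mktuple tpermL.
Qed.

End cube_integrals.

Lemma Rintegral_sum d (T : measurableType d) (R : realType)
    (m : {measure set T -> \bar R}) (J : Type) (s : seq J) (F : J -> T -> R) :
  (forall j, m.-integrable setT (EFin \o F j)) ->
  \int[m]_x (\sum_(j <- s) F j x) = \sum_(j <- s) \int[m]_x F j x.
Proof.
move=> Fi; elim: s => [|j s IH].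
  rewrite big_nil; under eq_Rintegral do rewrite big_nil.
  by rewrite /Rintegral integral0.
rewrite big_cons -IH -RintegralD//.
  by under eq_Rintegral do rewrite big_cons.
have : m.-integrable setT (fun x => \sum_(j <- s) (EFin \o F j) x)%E.
  by apply: integrable_sum => // j _; exact: Fi.
by apply: eq_integrable => // x _; rewrite /= sumEFin.
Qed.

Lemma ae_eq_Rintegral d (T : measurableType d) (R : realType)
    (m : {measure set T -> \bar R}) (f g : T -> R) :
  measurable_fun [set: T] f -> measurable_fun [set: T] g ->
  {ae m, forall x, f x = g x} -> \int[m]_x f x = \int[m]_x g x.
Proof.
move=> mf mg fg; congr fine; apply: ae_eq_integral => //;
  try exact/measurable_EFinP.
by apply: filterS fg => x -> _.
Qed.

Lemma bounded_integrable d (T : measurableType d) (R : realType)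
    (P : probability T R) (f : T -> R) (M : R) :
  measurable_fun [set: T] f -> (forall x, `|f x| <= M) ->
  P.-integrable setT (EFin \o f).
Proof.
move=> mf fM; apply: measurable_bounded_integrable => //.
  by rewrite [X in (X < _)%E](@probability_setT _ _ _ P) ltry.
exists M; split; first exact: num_real.
by move=> N MN x _; apply: le_trans (ltW MN).
Qed.

Lemma le_norm_xlnx (R : realType) (x : R) : 0 <= x <= 1 -> `|x * ln x| <= 1.
Proof.
move=> /andP[x0 x1]; have [->|xn0] := eqVneq x 0; first by rewrite mul0r normr0.
have xgt0 : 0 < x by rewrite lt_neqAle eq_sym xn0.
rewrite ler0_norm ?pmulr_rle0 ?ln_le0// -mulrN -lnV ?posrE//.
rewrite -[leRHS](mulfV xn0) ler_pM2l//; apply/ltW/ln_sublinear.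
by rewrite invr_gt0.
Qed.

(** * The AM-GM inequality with its equality case *)

Section power_mean_defect.
Variables (R : realType) (n : nat) (E : 'I_n.+1 -> R).
Hypothesis E0 : forall i, 0 <= E i.

Let S := n.+1%:R^-1 * \sum_i E i ^+ n.+1.

Let S0 : 0 <= S.
Proof.
by rewrite mulr_ge0 ?invr_ge0// sumr_ge0// => i _; rewrite exprn_ge0.
Qed.

(** AM-GM for the numbers [E i ^+ n.+1], in the form that also records when equality holds. *)
Let AGM : (\prod_i E i) ^+ n.+1 <= S ^+ n.+1 ?=
  iff [forall i in 'I_n.+1, forall j in 'I_n.+1, E i ^+ n.+1 == E j ^+ n.+1].
Proof.
have := @leif_AGM R 'I_n.+1 predT (fun i => E i ^+ n.+1).
rewrite /= card_ord /S [_^-1 * _]mulrC prodrXl; apply=> i _.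
exact: exprn_ge0.
Qed.

Lemma prod_le_power_mean : \prod_i E i <= S.
Proof. by rewrite -(@ler_pXn2r _ n.+1) ?nnegrE ?prodr_ge0// AGM. Qed.

Lemma prod_eq_power_mean i j : \prod_i E i = S -> E i = E j.
Proof.
move=> ES; have [_] := AGM; rewrite ES eqxx => /esym/forall_inP/(_ i isT).
by move=> /forall_inP/(_ j isT)/eqP/pexpIrn; apply; rewrite ?nnegrE.
Qed.

End power_mean_defect.

(** * The functional as an integral over the simplex minus a defect *)

Section objective_bound.
Variables (R : realType) (c k : nat).
Local Notation v := k.+2.
Local Notation I := (measurableTypeR R).
Local Notation mu := (leb01 R).
Local Notation mun := (leb01n R v).
Variable W : v.-tuple I -> R.
Hypothesis hW : Wspace W.
Hypothesis hWpos : {ae mun, forall x, 0 < W x}.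
Hypothesis hWreg : {ae mu, forall x, Vdeg W x = 1}.
Implicit Types (theta : R) (f g : I -> 'rV[R]_c) (x : 'rV[R]_c).

Definition coord_measurable f :=
  forall r, measurable_fun [set: I] (fun u => f u 0 r).

Let Wi : mun.-integrable setT (EFin \o W). Proof. by case: hW. Qed.

Let mW : measurable_fun [set: v.-tuple I] W.
Proof. apply/measurable_EFinP. exact: (measurable_int _ Wi). Qed.

Lemma coord_measurable_tnth f r (a : 'I_v) : coord_measurable f ->
  measurable_fun [set: v.-tuple I] (fun t => f (tnth t a) 0 r).
Proof.
move=> mf; apply: (measurableT_comp (mf r)); exact: measurable_tnth.
Qed.

Lemma measurable_Gmono_integrand f r : coord_measurable f ->
  measurable_fun [set: v.-tuple I] (fun t => \prod_(a < v) f (tnth t a) 0 r).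
Proof.
by move=> mf; apply: measurable_prod => a _; exact: coord_measurable_tnth.
Qed.

Lemma measurable_entropy_integrand f : coord_measurable f ->
  measurable_fun [set: I] (fun u => \sum_(r < c) f u 0 r * ln (f u 0 r)).
Proof.
move=> mf; apply: measurable_sum => r.
have mxlnx := continuous_measurable_fun (@continuous_xlnx R).
exact: (measurableT_comp mxlnx (mf r)).
Qed.

Lemma objective_ae theta f g : coord_measurable f -> coord_measurable g ->
  {ae mu, forall u, f u = g u} -> objective W theta f = objective W theta g.
Proof.
move=> mf mg fg; rewrite /objective; congr (_ * _ - _ - _).
- apply: eq_bigr => r _; apply: ae_eq_Rintegral.
  + by apply: measurable_funM => //; exact: measurable_Gmono_integrand.
  + by apply: measurable_funM => //; exact: measurable_Gmono_integrand.
  + have := ae_leb01n_tnth v fg; apply: filterS => t ft.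
    by congr (_ * _); apply: eq_bigr => a _; rewrite ft.
- apply: ae_eq_Rintegral; try exact: measurable_entropy_integrand.
  by apply: filterS fg => u ->.
Qed.

Section simplex_valued.
Variable f : I -> 'rV[R]_c.
Hypothesis mf : coord_measurable f.
Hypothesis fS : forall u, simplex (f u).

Let f0 u r : 0 <= f u 0 r. Proof. exact: simplex_coord_ge0. Qed.
Let f1 u r : f u 0 r <= 1. Proof. exact: simplex_coord_le1. Qed.

Let norm_pow u r : `|f u 0 r ^+ v| <= 1.
Proof. by rewrite ger0_norm ?exprn_ge0// exprn_ile1. Qed.

Let measurable_pow r : measurable_fun [set: I] (fun u => f u 0 r ^+ v).
Proof. by apply: measurable_funX; exact: mf. Qed.

Definition power_mean_defect r (t : v.-tuple I) : R :=
  v%:R^-1 * (\sum_(a < v) f (tnth t a) 0 r ^+ v) -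
  \prod_(a < v) f (tnth t a) 0 r.

Lemma power_mean_defect_ge0 r t : 0 <= power_mean_defect r t.
Proof. by rewrite subr_ge0; apply: prod_le_power_mean => a. Qed.

Let prod01 r (t : v.-tuple I) : 0 <= \prod_(a < v) f (tnth t a) 0 r <= 1.
Proof.
rewrite prodr_ge0//= (@le_trans _ _ (\prod_(a < v) 1))//; last by rewrite big1.
by apply: ler_prod => a _; rewrite f0 f1.
Qed.

Lemma measurable_power_mean_defect r :
  measurable_fun [set: v.-tuple I] (power_mean_defect r).
Proof.
apply: measurable_funB; last exact: measurable_Gmono_integrand.
apply: measurable_funM => //; apply: measurable_sum => a.
by apply: measurable_funX; exact: coord_measurable_tnth.
Qed.

(** By symmetry and unit degree, each of the [v] powers integrates against [W] to the same integral
    over [0,1], so their mean does too. *)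
Lemma integral_power_mean_defect r :
  \int[mun]_t (W t * power_mean_defect r t) =
  \int[mu]_u (f u 0 r ^+ v) - Gmono W r f.
Proof.
have Wpi (a : 'I_v) :
    mun.-integrable setT (fun t => (W t * f (tnth t a) 0 r ^+ v)%:E).
  apply: (integrable_mulr Wi) => [|t]; last exact: norm_pow.
  by apply: measurable_funX; exact: coord_measurable_tnth.
have Gi : mun.-integrable setT
    (fun t => (W t * \prod_(a < v) f (tnth t a) 0 r)%:E).
  apply: (integrable_mulr Wi); first exact: measurable_Gmono_integrand.
  by move=> t; have /andP[? ?] := prod01 r t; rewrite ger0_norm.
have Spi : mun.-integrable setT
    (fun t => (\sum_(a < v) W t * f (tnth t a) 0 r ^+ v)%:E).
  have : mun.-integrable setT
      (fun t => \sum_(a < v) (W t * f (tnth t a) 0 r ^+ v)%:E)%E.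
    by apply: integrable_sum => // a _; exact: Wpi.
  by apply: eq_integrable => // t _; rewrite sumEFin.
transitivity (\int[mun]_t (v%:R^-1 * (\sum_(a < v) W t * f (tnth t a) 0 r ^+ v)
    - W t * \prod_(a < v) f (tnth t a) 0 r)).
  apply: eq_Rintegral => t _; rewrite /power_mean_defect mulrBr; congr (_ - _).
  by rewrite mulrCA mulr_sumr.
rewrite RintegralB//; last exact: (integrableZl measurableT v%:R^-1 Spi).
congr (_ - _); rewrite RintegralZl// Rintegral_sum//.
rewrite (eq_bigr (fun=> \int[mu]_u (f u 0 r ^+ v))).
  by rewrite sumr_const card_ord -[X in _ * X]mulr_natl mulKf// pnatr_eq0.
move=> a _; congr fine.
by apply: (integral_regular_tnth a hW hWreg (h := fun u => f u 0 r ^+ v)).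
Qed.

Lemma integral_simplex_obj theta :
  \int[mu]_u simplex_obj v theta (f u) =
  theta * \sum_(r < c) \int[mu]_u (f u 0 r ^+ v) -
  \int[mu]_u (\sum_(r < c) f u 0 r * ln (f u 0 r)).
Proof.
have powi r : mu.-integrable setT (EFin \o (fun u => f u 0 r ^+ v)).
  exact: bounded_integrable (measurable_pow r) (norm_pow^~ r).
have entri r : mu.-integrable setT (EFin \o (fun u => f u 0 r * ln (f u 0 r))).
  apply: (@bounded_integrable _ _ _ _ _ 1) => [|u].
    have mxlnx := continuous_measurable_fun (@continuous_xlnx R).
    exact: (measurableT_comp mxlnx (mf r)).
  by apply: le_norm_xlnx; rewrite f0 f1.
have sumi (F : 'I_c -> I -> R) :
    (forall r, mu.-integrable setT (EFin \o F r)) ->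
    mu.-integrable setT (EFin \o (fun u => \sum_(r < c) F r u)).
  move=> Fi.
  have : mu.-integrable setT (fun u => \sum_(r < c) (EFin \o F r) u)%E.
    by apply: integrable_sum => // r _; exact: Fi.
  by apply: eq_integrable => // u _; rewrite /= sumEFin.
rewrite -Rintegral_sum// -RintegralZl//; last exact: sumi.
rewrite -RintegralB//; last 2 first.
- exact: (integrableZl measurableT theta (sumi _ powi)).
- exact: sumi.
by apply: eq_Rintegral => u _; rewrite simplex_objE.
Qed.

(** The upper bound and its equality case both follow from this identity: the first term is bounded
    pointwise and the subtracted one is nonnegative for [theta >= 0]. *)
Lemma objective_split theta : objective W theta f + ln c%:R =
  \int[mu]_u simplex_obj v theta (f u) -
  theta * \sum_(r < c) \int[mun]_t (W t * power_mean_defect r t).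
Proof.
rewrite integral_simplex_obj /objective subrK.
under [X in _ = _ - _ * X]eq_bigr do rewrite integral_power_mean_defect.
by rewrite sumrB mulrBr; lra.
Qed.

(** [W] is positive only almost everywhere, so the integrand is replaced by its norm before
    positivity is used. *)
Let defect_norm r : \int[mun]_t (W t * power_mean_defect r t) =
  \int[mun]_t (`|W t * power_mean_defect r t|).
Proof.
have mWD : measurable_fun [set: v.-tuple I]
    (fun t => W t * power_mean_defect r t).
  by apply: measurable_funM => //; exact: measurable_power_mean_defect.
apply: ae_eq_Rintegral => //; first exact: measurableT_comp.
apply: filterS hWpos => t Wt; rewrite ger0_norm// mulr_ge0 ?(ltW Wt)//.
exact: power_mean_defect_ge0.
Qed.

Lemma integral_defect_ge0 r : 0 <= \int[mun]_t (W t * power_mean_defect r t).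
Proof. by rewrite defect_norm Rintegral_ge0. Qed.

(** Positivity of [W] forces the defect to vanish almost everywhere. The equality case of AM-GM then
    identifies the values at the first two variables, and [ae_leb01n_swap_const] applies. *)
Lemma integral_defect_eq0_const r :
  \int[mun]_t (W t * power_mean_defect r t) = 0 ->
  exists y, {ae mu, forall u, f u 0 r = y}.
Proof.
rewrite defect_norm => int0.
have WDi : mun.-integrable setT (fun t => (W t * power_mean_defect r t)%:E).
  apply: (integrable_mulr Wi); first exact: measurable_power_mean_defect.
  move=> t; rewrite ger0_norm ?power_mean_defect_ge0// lerBlDr.
  rewrite (@le_trans _ _ 1)//; last by rewrite lerDl; case/andP: (prod01 r t).
  rewrite mulrC ler_pdivrMr// mul1r (@le_trans _ _ (\sum_(a < v) 1))//.
    by apply: ler_sum => a _; rewrite exprn_ile1.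
  by rewrite sumr_const card_ord.
have WDabs : (\int[mun]_t `|(W t * power_mean_defect r t)%:E| = 0)%E.
  rewrite -[LHS]fineK; first by rewrite -[RHS]/(0%:E) -int0.
  by apply: integrable_fin_num => //; exact: integrable_abse.
have /(ae_eq_integral_abs mun measurableT)[/(_ WDabs) WD0 _] :=
  measurable_int _ WDi.
apply: (@ae_leb01n_swap_const _ k (fun u => f u 0 r)) => //.
move: hWpos WD0; apply: filterS2 => t Wt /(_ Logic.I) [/eqP].
rewrite mulf_eq0 (gt_eqF Wt) /= subr_eq0 => /eqP/esym Dt.
exact: (prod_eq_power_mean (E := fun a => f (tnth t a) 0 r)).
Qed.

End simplex_valued.

End objective_bound.

(** * Maximizers over functions are constant maximizers on the simplex *)

Section reduction.
Variables (R : realType) (c k : nat).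
Hypothesis hc : (1 < c)%N.
Local Notation v := k.+2.
Local Notation I := (measurableTypeR R).
Local Notation mu := (leb01 R).
Local Notation mun := (leb01n R v).
Local Notation Phi := (@simplex_obj R c v).
Local Notation Phi_max := (@simplex_max R c v).
Variable W : v.-tuple I -> R.
Hypothesis hW : Wspace W.
Hypothesis hWpos : {ae mun, forall x, 0 < W x}.
Hypothesis hWreg : {ae mu, forall x, Vdeg W x = 1}.
Variable theta : R.
Hypothesis theta0 : 0 <= theta.
Implicit Types (f g : I -> 'rV[R]_c) (x y : 'rV[R]_c).

Lemma ae_leb01_itv : {ae mu, forall u : I, 0 <= (u : R) <= 1}.
Proof.
exists (~` `[0%R, 1%R]%classic : set I); split.
- by apply: measurableC; exact: measurable_itv.
- by rewrite /leb01 /mrestr setICl measure0.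
- by move=> u /= nu; rewrite in_itv /=.
Qed.

(** Members of [Fspace] are simplex-valued only on [0,1]. Composition with this retraction makes
    them so everywhere and changes nothing almost everywhere. *)
Definition clamp (u : I) : I := Num.max (0 : R) (Num.min (u : R) 1).

Lemma measurable_clamp : measurable_fun [set: I] clamp.
Proof.
apply: measurable_maxr; first exact: measurable_cst.
by apply: measurable_minr; [exact: measurable_id | exact: measurable_cst].
Qed.

Lemma Fspace_clamp f : Fspace f -> [/\ coord_measurable (f \o clamp),
  forall u, simplex ((f \o clamp) u) & {ae mu, forall u, f u = (f \o clamp) u}].
Proof.
move=> [mf fS]; split.
- by move=> r; exact: (measurableT_comp (mf r) measurable_clamp).
- move=> u; apply: fS; rewrite /clamp le_max lexx /=.
  by rewrite ge_max ler01 ge_min lexx orbT.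
- apply: filterS ae_leb01_itv => u /andP[u0 u1] /=; congr f.
  by rewrite /clamp min_l// max_r.
Qed.

Lemma Fspace_cst x : simplex x -> Fspace (cst x : I -> 'rV[R]_c).
Proof. by move=> xS; split=> // r; exact: measurable_cst. Qed.

Lemma coord_measurable_cst x : coord_measurable (cst x : I -> 'rV[R]_c).
Proof. by move=> r; exact: measurable_cst. Qed.

Lemma Rintegral_leb01_cst (a : R) : \int[mu]_(_ in setT) a = a.
Proof.
by rewrite Rintegral_cst// [X in fine X](@probability_setT _ _ _ mu) mulr1.
Qed.

Lemma objective_cst x : simplex x ->
  objective W theta (cst x) = Phi theta x - ln c%:R.
Proof.
move=> xS.
have /eqP := objective_split hW hWreg (coord_measurable_cst x) (fun=> xS) theta.
rewrite eq_sym -subr_eq => /eqP/esym->; congr (_ - _).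
rewrite [\int[mu]_u _](Rintegral_leb01_cst (Phi theta x)).
rewrite big1 ?mulr0 ?subr0// => r _.
transitivity (\int[mun]_t (0 : R)); last by rewrite /Rintegral integral0.
apply: eq_Rintegral => t _.
rewrite /power_mean_defect /= sumr_const prodr_const card_ord.
by rewrite -[X in _ * X - _]mulr_natl mulKf ?pnatr_eq0// subrr mulr0.
Qed.

Section valued.
Variable f : I -> 'rV[R]_c.
Hypothesis mf : coord_measurable f.
Hypothesis fS : forall u, simplex (f u).

Lemma integrable_simplex_obj :
  mu.-integrable setT (EFin \o (fun u => Phi theta (f u))).
Proof.
apply: (@bounded_integrable _ _ _ _ _ (\sum_(r < c) (`|theta| + 1))) => [|u].
  apply: measurable_sum => r.
  have mterm := continuous_measurable_fun
    (@continuous_simplex_obj_term R v theta).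
  exact: (measurableT_comp mterm (mf r)).
apply: le_trans (ler_norm_sum _ _ _) _; apply: ler_sum => r _.
have [fr0 fr1] := ((simplex_coord_ge0 r (fS u)), (simplex_coord_le1 r (fS u))).
apply: le_trans (ler_normB _ _) _; apply: lerD; last first.
  by apply: le_norm_xlnx; rewrite fr0.
by rewrite normrM ler_piMr// ger0_norm ?exprn_ge0// exprn_ile1.
Qed.

Lemma integral_simplex_obj_le x : Phi_max theta x ->
  \int[mu]_u Phi theta (f u) <= Phi theta x.
Proof.
move=> [_ xmax].
have -> : Phi theta x = \int[mu]_u cst (Phi theta x) u.
  by rewrite Rintegral_leb01_cst.
apply: le_Rintegral => //; first exact: integrable_simplex_obj.
- exact: finite_measure_integrable_cst.
- by move=> u _; exact: xmax.
Qed.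

Lemma sum_integral_defect_ge0 :
  0 <= theta * \sum_(r < c) \int[mun]_t (W t * power_mean_defect f r t).
Proof.
by rewrite mulr_ge0// sumr_ge0// => r _; exact: (integral_defect_ge0 hW).
Qed.

Lemma objective_le x : Phi_max theta x ->
  objective W theta f <= Phi theta x - ln c%:R.
Proof.
move=> /integral_simplex_obj_le xmax; rewrite lerBrDr.
rewrite (objective_split hW hWreg mf fS); apply: le_trans xmax.
by rewrite lerBlDr lerDl sum_integral_defect_ge0.
Qed.

Lemma objective_eq x : Phi_max theta x ->
  objective W theta f = Phi theta x - ln c%:R ->
  \int[mu]_u Phi theta (f u) = Phi theta x /\
  theta * \sum_(r < c) \int[mun]_t (W t * power_mean_defect f r t) = 0.
Proof.
move=> xmax fx; have h1 := integral_simplex_obj_le xmax.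
have h2 := sum_integral_defect_ge0.
have h3 := objective_split hW hWreg mf fS theta.
by split; lra.
Qed.

(** The gap between the maximum and [Phi theta (f u)] is nonnegative with zero integral, hence zero
    almost everywhere. *)
Lemma integral_simplex_obj_eq x : Phi_max theta x ->
  \int[mu]_u Phi theta (f u) = Phi theta x ->
  {ae mu, forall u, Phi_max theta (f u)}.
Proof.
move=> xmax intE; have Fi := integrable_simplex_obj.
have ci := finite_measure_integrable_cst mu (Phi theta x) measurableT.
pose F u := Phi theta x - Phi theta (f u).
have FI : mu.-integrable setT (EFin \o F).
  exact: (integrableB measurableT ci Fi).
have F0 : (\int[mu]_u `|(F u)%:E| = 0)%E.
  rewrite -[LHS]fineK; last first.
    by apply: integrable_fin_num => //; exact: integrable_abse.
  rewrite -[RHS]/(0%:E); congr EFin.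
  transitivity (\int[mu]_u F u).
    by apply: eq_Rintegral => u _; rewrite ger0_norm// subr_ge0 xmax.2.
  by rewrite RintegralB// intE Rintegral_leb01_cst subrr.
have /(ae_eq_integral_abs mu measurableT)[/(_ F0) + _] := measurable_int _ FI.
apply: filterS => u /(_ Logic.I)[/eqP]; rewrite subr_eq0 => /eqP uE.
by split=> // y yS; rewrite -uE; exact: xmax.2.
Qed.

End valued.

Lemma simplex_max_maximizer x : Phi_max theta x ->
  maximizer W theta (cst x : I -> 'rV[R]_c).
Proof.
move=> xmax; split=> [|g gF]; first exact: Fspace_cst xmax.1.
have [mg gS gE] := Fspace_clamp gF.
rewrite (objective_ae hW theta _ _ gE)//; last exact: gF.1.
by rewrite objective_cst; [exact: objective_le | exact: xmax.1].
Qed.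

Lemma maximizer_objective x f : Phi_max theta x -> maximizer W theta f ->
  objective W theta f = Phi theta x - ln c%:R.
Proof.
move=> xmax [fF fmax]; apply/le_anti; apply/andP; split.
  rewrite -objective_cst; last exact: xmax.1.
  by apply: (simplex_max_maximizer xmax).2.
by rewrite -objective_cst ?(fmax _ (Fspace_cst xmax.1)) //; exact: xmax.1.
Qed.

Lemma maximizer_ae_constant f : maximizer W theta f ->
  exists x, {ae mu, forall u, f u = x}.
Proof.
move=> fmax; have [mg gS gE] := Fspace_clamp fmax.1.
set g := f \o clamp in mg gS gE.
have [x xmax] := @simplex_max_exists R c v theta (ltnW hc).
have := maximizer_objective xmax fmax.
rewrite (objective_ae hW theta _ _ gE)//; last exact: fmax.1.1.
move=> /(objective_eq mg gS xmax)[intE defE].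
suff [y yE] : exists y, {ae mu, forall u, g u = y}.
  by exists y; move: gE yE; apply: filterS2 => u -> ->.
(* At [theta = 0] the defect term says nothing; almost every value of [g] then maximizes the entropy
   and is uniform. For [theta > 0] each color has zero defect. *)
move: theta0; rewrite le_eqVlt => /orP[/eqP theta_eq0|theta_gt0].
  exists (uniform_vec R c).
  apply: filterS (integral_simplex_obj_eq mg gS xmax intE) => u.
  by apply: simplex_max_small_uniform; rewrite -?theta_eq0 ?mul0r.
have {}defE r : \int[mun]_t (W t * power_mean_defect g r t) = 0.
  move/eqP: defE; rewrite mulf_eq0 (gt_eqF theta_gt0) /= psumr_eq0.
    by move=> /allP/(_ r (mem_index_enum _))/eqP.
  by move=> j _; exact: (integral_defect_ge0 hW).
have /choice[y yE] r : exists a : R, {ae mu, forall u, g u 0 r = a}.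
  exact: (integral_defect_eq0_const hW hWpos mg gS (defE r)).
exists (\row_r y r).
have gy : {ae mu, forall u, forall r, g u 0 r = y r} by exact: filter_forall.
by apply: filterS gy => u uy; apply/rowP => r; rewrite mxE uy.
Qed.

(** A maximizer equal to [x] almost everywhere has the objective of the constant [x], and comparison
    with constants shows [x] maximal on the simplex. The converse is [simplex_max_maximizer]. *)
Lemma optimizersE : optimizers c W theta = [set x | Phi_max theta x].
Proof.
apply/seteqP; split=> [x [xS [f fmax fx]]|x xmax]; last first.
  split; first exact: xmax.1.
  by exists (cst x); [exact: simplex_max_maximizer | exact: aeW].
split=> // y yS; have := fmax.2 _ (Fspace_cst yS).
rewrite (objective_ae hW theta _ _ fx).
- by rewrite !objective_cst// lerBlDr subrK.
- exact: fmax.1.1.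
- exact: coord_measurable_cst.
Qed.

End reduction.

Theorem proposition2p10 (R : realType) (c v : nat)
    (hc : (1 < c)%N) (hv : (1 < v)%N)
    (W : v.-tuple (measurableTypeR R) -> R)
    (hW : Wspace W)
    (hWpos : {ae leb01n R v, forall x, 0 < W x})
    (hWreg : {ae leb01 R, forall x, Vdeg W x = 1}) :
  [/\ forall (theta : R) (f : measurableTypeR R -> 'rV[R]_c), 0 <= theta ->
        maximizer W theta f ->
        exists x : 'rV[R]_c, {ae leb01 R, forall u, f u = x},
      forall (theta : R) (x : 'rV[R]_c), 0 <= theta ->
        optimizers c W theta x ->
        (forall r, r != first_color hc -> x 0 r <= x 0 (first_color hc)) ->
        exists y : R, [/\ 0 <= y < 1,
          x 0 (first_color hc) = c%:R^-1 * (1 + (c%:R - 1) * y) &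
          forall r, r != first_color hc -> x 0 r = c%:R^-1 * (1 - y)]
    & exists thetac : R, [/\ 0 < thetac,
        forall theta : R, 0 <= theta -> theta < thetac ->
          optimizers c W theta = [set uniform_vec R c],
        forall theta : R, thetac < theta ->
          ((optimizers c W theta #= `I_c)%card /\
           ~ optimizers c W theta (uniform_vec R c))
      & exists xopt : R -> 'rV[R]_c,
          (forall theta : R, thetac < theta -> forall x : 'rV[R]_c,
             (optimizers c W theta x /\
              forall r, r != first_color hc -> x 0 r < x 0 (first_color hc))
             <-> x = xopt theta) /\
          {within `]thetac, +oo[, continuous xopt}]].
Proof.
case: v hv W hW hWpos hWreg => [//|[//|k]] _ W hW hWpos hWreg; split.
- by move=> theta f theta0; exact: (maximizer_ae_constant hc hW hWpos hWreg).
- move=> theta x theta0; rewrite (optimizersE c hW hWpos hWreg theta0) => xmax.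
  exact: simplex_max_form xmax.
- have thetac0 := @critical_theta_gt0 R c k hc.
  have optE theta : critical_theta R c k < theta ->
      optimizers c W theta = [set x | simplex_max k.+2 theta x].
    move=> tt; apply: (optimizersE c hW hWpos hWreg).
    exact: ltW (lt_trans thetac0 tt).
  exists (critical_theta R c k); split=> [//|theta theta0 tt|theta tt|].
  + rewrite (optimizersE c hW hWpos hWreg theta0).
    by apply/seteqP; split=> x /(subcritical hc x theta0 tt).
  + by rewrite optE//; split; [exact: card_simplex_max | exact: supercritical].
  + have [xopt [xoptP xoptC]] := @simplex_max_branch R c k hc.
    exists xopt; split=> // theta tt x.
    by rewrite optE//; exact: xoptP.
Qed.
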